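(* Let $1\leqslant k\leqslant n$ be integers, let $\lambda\vdash k$ be branching-balanced, and let $u_1,\ldots,u_n$ be real numbers with $u_1,\ldots,u_{n-1}>0>u_n$. If \[ \sum_{i=1}^n u_i^{-1}\leqslant 0, \] then $\mathscr P^\lambda(u_1,\ldots,u_n)\succeq 0$.
   Context: Group algebra order: let $*$ be the antilinear involution on $\mathbb C[\mathfrak S_n]$ with $\sigma^*=\sigma^{-1}$. For self-adjoint $A\in\mathbb C[\mathfrak S_n]$, write $A\succeq 0$ if $\rho(A)$ is positive semidefinite in every (finite-dimensional) unitary representation $\rho$ of $\mathfrak S_n$. Partitions: $\lambda\vdash k$ means $\lambda$ is a partition of $k$; $S^\lambda$ is the (complex) Specht module, $\chi^\lambda$ its character, $f^\lambda=\dim S^\lambda$ (so $S^{(k)}$ is trivial and $S^{(1^k)}$ is sign). Write $\mu\gtrdot\lambda$ if $\mu$ is obtained from $\lambda$ by adding one box. For $\lambda\vdash k$ and $\mu\gtrdot\lambda$ put $p^\uparrow(\lambda,\mu)=\frac{f^\mu}{(k+1)f^\lambda}$, and for nonempty $\lambda$ put $\vartheta(\lambda)=\max_{\mu\gtrdot\lambda}p^\uparrow(\lambda,\mu)$. A nonempty partition $\lambda$ is branching-balanced if $\vartheta(\lambda)\leqslant\frac12$. Universal Plücker coordinates: let $[n]=\{1,\ldots,n\}$ and for $X\subseteq[n]$ regard $\mathfrak S_X$ as the subgroup of $\mathfrak S_n$ fixing the complement of $X$. For $\mathbf u=(u_1,\ldots,u_n)\in\mathbb C^n$ and $\lambda\vdash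 k$ with $k\leqslant n$, \[ \mathscr P^\lambda(\mathbf u)=\sum_{\substack{X\subseteq[n]\\|X|=k}}\Bigl(\sum_{\sigma\in\mathfrak S_X}\chi^\lambda(\sigma)\sigma\Bigr)\prod_{a\in[n]\setminus X}u_a\in\mathbb C[\mathfrak S_n].\] *)

(* Defs.v *)
From HB Require Import structures.
From mathcomp Require Import all_boot all_order all_fingroup all_algebra.
From mathcomp Require Import mxrepresentation sesquilinear spectral.
From mathcomp Require Import reals.
From mathcomp.real_closed Require Import complex.

Set Implicit Arguments.
Unset Strict Implicit.
Unset Printing Implicit Defensive.

Import Order.TTheory GRing.Theory Num.Theory.
Local Open Scope ring_scope.

Definition is_partition (la : seq nat) : bool :=
  sorted geq la && (0%N \notin la).

Definition partition_of (k : nat) (la : seq nat) : bool :=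
  is_partition la && (sumn la == k).

(* The partitions obtained from [la] by adding one box: [incr_nth la i] adds a
   box to row [i], row [size la] being the first empty one. *)
Definition add_box (la : seq nat) : seq (seq nat) :=
  [seq mu <- [seq incr_nth la i | i <- iota 0 (size la).+1] | is_partition mu].

(* [Sym X] is the subgroup of [{perm T}] fixing the complement of [X].  For
   [la] a partition of [#|X|], the boxes of the diagram of [la], read row by
   row, are filled with the elements of [X] in the order of [enum X]; this is
   the tableau used below. *)
Definition tableau_row (la : seq nat) (T : finType) (X : {set T}) (x : T) : nat :=
  reshape_index la (index x (enum X)).

Definition tableau_col (la : seq nat) (T : finType) (X : {set T}) (x : T) : nat :=
  reshape_offset la (index x (enum X)).

Definition row_stab (la : seq nat) (T : finType) (X : {set T}) : {set {perm T}} :=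
  [set s in Sym X | [forall x in X, tableau_row la X (s x) == tableau_row la X x]].

Definition col_stab (la : seq nat) (T : finType) (X : {set T}) : {set {perm T}} :=
  [set s in Sym X | [forall x in X, tableau_col la X (s x) == tableau_col la X x]].

(* Young symmetrizer, in the group ring of [Sym X] encoded as in the library by
   matrices of the regular representation.  The product [(p * q)%g] applies [p]
   first, so with composition of functions this is b * a, where
   a = \sum_p p and b = \sum_q sgn(q) q. *)
Definition young_symmetrizer (F : fieldType) (la : seq nat) (T : finType)
    (X : {set T}) : 'M[F]_#|Sym X| :=
  \sum_(p in row_stab la X) \sum_(q in col_stab la X)
    (-1) ^+ (odd_perm q) *: regular_repr F (Sym_group X) (p * q)%g.

Definition specht_mx (F : fieldType) (la : seq nat) (T : finType)
    (X : {set T}) : 'M[F]_#|Sym X| :=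
  cyclic_mx (regular_repr F (Sym_group X))
    (gring_row (young_symmetrizer F la X)).

(* The Specht module as the ideal of the group ring generated by the Young
   symmetrizer, which is the span of the polytabloids when the permutation
   module on tabloids is identified with the ideal generated by a.  Matrices
   act on row vectors on the right, so a right module for the left-to-right
   product of permutations is a left module for composition. *)
Definition specht_repr (F : fieldType) (la : seq nat) (T : finType)
    (X : {set T}) : mx_representation F (Sym_group X) (\rank (specht_mx F la X)) :=
  submod_repr (cyclic_mx_module (regular_repr F (Sym_group X))
    (gring_row (young_symmetrizer F la X))).

Definition specht_char (F : fieldType) (la : seq nat) (T : finType)
    (X : {set T}) (s : {perm T}) : F :=
  \tr (specht_repr F la X s).

Definition specht_dim (F : fieldType) (la : seq nat) : nat :=
  \rank (specht_mx F la [set: 'I_(sumn la)]).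

Definition p_up (F : fieldType) (la mu : seq nat) : rat :=
  (specht_dim F mu)%:R / ((sumn la).+1%:R * (specht_dim F la)%:R).

(* The default value 0 is harmless: transition probabilities are nonnegative
   and [add_box la] is nonempty. *)
Definition vartheta (F : fieldType) (la : seq nat) : rat :=
  \big[Num.max/0]_(mu <- add_box la) p_up F la mu.

Definition branching_balanced (F : fieldType) (la : seq nat) : Prop :=
  [/\ is_partition la, la != [::] & vartheta F la <= 2%:R^-1].

Section GroupAlgebra.

Variables (C : numClosedFieldType) (n : nat).

Local Notation G := [set: 'S_n]%G.

Definition perm_alg (s : 'S_n) : 'M[C]_#|G| := regular_repr C G s.

Definition perm_coef (A : 'M[C]_#|G|) (s : 'S_n) : C :=
  gring_row A 0 (gring_index G s).

Definition perm_star (A : 'M[C]_#|G|) : 'M[C]_#|G| :=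
  \sum_(s : 'S_n) (perm_coef A s)^* *: perm_alg s^-1.

Definition psdmx (m : nat) (M : 'M[C]_m) : Prop :=
  M \is hermsymmx /\
  forall v : 'rV[C]_m, 0 <= (v *m M *m (map_mx Num.conj v)^T) 0 0.

Definition unitary_repr (m : nat) (rG : mx_representation C G m) : Prop :=
  forall s : 'S_n, rG s \is unitarymx.

(* [gring_op rG A] is the image of [A] under the linear extension of [rG]. *)
Definition perm_alg_ge0 (A : 'M[C]_#|G|) : Prop :=
  [/\ (A \in group_ring C G)%MS,
      perm_star A = A
    & forall (m : nat) (rG : mx_representation C G m),
        unitary_repr rG -> psdmx (gring_op rG A)].

Definition plucker (la : seq nat) (u : 'I_n -> C) : 'M[C]_#|G| :=
  \sum_(X : {set 'I_n} | #|X| == sumn la)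
    (\prod_(a in ~: X) u a) *:
      (\sum_(s in Sym X) specht_char C la X s *: perm_alg s).

End GroupAlgebra.

(* Main.v *)
(** For [X] of size [k] let [c_X] be the sum of chi^la(s) s over [Sym X].  Put
    [y_a = 1/u_a], let [w] be the index of the negative weight and [U < 0] the
    product of all weights.  Then P^la(u) = U * sum_X y^X c_X, where
    [y^X] is the product of the [y_a], [a \in X], and regrouping gives
      P^la(u) = -U * sum_{X containing w} t_X c_X
              - U * sum_W y^{W - w} (sum_{i in W} c_{W - i} - 2 c_{W - w}),
    with [W] of size [k+1] containing [w].  The condition on the sum of the
    [y_a] makes the coefficients [t_X] nonnegative.  By the branching rule,
    sum_{i in W} c_{W - i} is the sum over [mu] obtained by adding a box to
    [la] of the central element of [mu] on [W], that is of (k+1)!/f^mu times a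
    central projection, while [c_{W - w}] is k!/f^la times a projection lying
    under the sum of those.  Positivity of the second summand is therefore
    (k+1)!/f^mu >= 2 k!/f^la, which is branching balance.

    The branching rule is proved by induction on [k], without modules.  Let
    [E] be the induced element and [S] the expected sum over [mu]: the norm of
    [E] is computed by the rule one level below and the number of addable boxes
    exceeds that of removable ones by one, while the pairing of [E] with each
    [mu] is at least the norm of the element of [mu], being a multiple of the
    rank of a nonzero idempotent.  Hence the norm of [E - S] is at most 0.
    Averaging the decomposition of 1 over the subgroups then gives the
    decomposition of 1 at level [k+1], and with it the restriction rule. *)
From HB Require Import structures.
Require Import Defs.
From mathcomp Require Import all_boot all_order all_fingroup all_algebra.
From mathcomp Require Import mxrepresentation sesquilinear spectral.
From mathcomp Require Import zify.
From mathcomp Require Import reals.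
From mathcomp.real_closed Require Import complex.

Set Implicit Arguments.
Unset Strict Implicit.
Unset Printing Implicit Defensive.

(** * Partitions *)

Section Partitions.

Implicit Types (la mu nu : seq nat).

Lemma partition_nth la i j : is_partition la -> (i <= j) ->
  (nth 0 la j <= nth 0 la i).
Proof.
case/andP=> sla _ ij; case: (ltnP j (size la)) => [jl|/(nth_default 0)->//].
have := sorted_leq_nth (rev_trans leq_trans) (@leqnn) 0 sla.
by move/(_ i j); rewrite !inE => -> //; apply: leq_ltn_trans jl.
Qed.

(** Rows past the end read as 0, so monotonicity can be asked at every index; the second condition
    excludes empty rows in the list. *)
Lemma is_partitionP la :
  reflect ((forall i, nth 0 la i.+1 <= nth 0 la i) /\
           (forall i, i < size la -> 0 < nth 0 la i)) (is_partition la).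
Proof.
apply: (iffP idP) => [pla|[dec pos]].
  split=> i; first exact: partition_nth.
  by case/andP: pla => _ n0 il; rewrite lt0n; apply: contraNneq n0 => <-; rewrite mem_nth.
apply/andP; split; first by apply/(sortedP 0) => i _; apply: dec.
by apply/negP => /(nthP 0)[i il e]; have := pos i il; rewrite e.
Qed.

Lemma partition_eq la mu : is_partition la -> is_partition mu ->
  (forall i, nth 0 la i = nth 0 mu i) -> la = mu.
Proof.
move=> /is_partitionP[_ posl] /is_partitionP[_ posm] e.
apply: (@eq_from_nth _ 0) => [|i _ //].
apply/eqP; rewrite eqn_leq; apply/andP; split; rewrite leqNgt; apply/negP => lt.
  by have := posl _ lt; rewrite e nth_default.
by have := posm _ lt; rewrite -e nth_default.
Qed.

Lemma sumn_incr_nth la i : sumn (incr_nth la i) = (sumn la).+1.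
Proof.
elim: la i => [|n la IH] [|i] //=; last by rewrite IH addnS.
by elim: i => //= i ->.
Qed.

Lemma is_partition_incr la i : is_partition la -> i <= size la ->
  is_partition (incr_nth la i) = (i == 0) || (nth 0 la i < nth 0 la i.-1).
Proof.
move=> /is_partitionP[dec pos] il; apply/is_partitionP/idP => [[dec' _]|lt].
  case: i il dec' => //= i il /(_ i); rewrite !nth_incr_nth eqxx (gtn_eqF (ltnSn i)).
  by rewrite add0n add1n.
split=> j; rewrite ?size_incr_nth !nth_incr_nth.
  have := dec j; case: (ltngtP i j.+1) lt => [|//|->]; last by rewrite /= (gtn_eqF (ltnSn j)); lia.
  - by case: (i == j); lia.
  by case: (i == j); lia.
case: ifP => ij jl; case: eqP => // e; rewrite add0n; apply: pos => //; lia.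
Qed.

Definition addable la := [seq i <- iota 0 (size la).+1 | (i == 0) || (nth 0 la i < nth 0 la i.-1)].
Definition removable la := [seq i <- iota 0 (size la) | nth 0 la i.+1 < nth 0 la i].

Lemma add_boxE la : is_partition la -> add_box la = [seq incr_nth la i | i <- addable la].
Proof.
move=> pla; rewrite /add_box filter_map; congr map; apply: eq_in_filter => i.
by rewrite mem_iota /= add0n ltnS => il; rewrite is_partition_incr.
Qed.

Lemma uniq_add_box la : uniq (add_box la).
Proof. by rewrite filter_uniq // map_inj_uniq ?iota_uniq //; apply: incr_nth_inj. Qed.

Lemma add_boxP la mu :
  reflect (exists2 i, i <= size la & mu = incr_nth la i /\ is_partition mu) (mu \in add_box la).
Proof.
rewrite mem_filter; apply: (iffP andP) => [[pm /mapP[j]]|[i il [-> pm]]].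
  by rewrite mem_iota /= add0n ltnS => il e; exists j.
by split=> //; apply: map_f; rewrite mem_iota /= add0n ltnS.
Qed.

(** Row i+1 can gain a box exactly when row i can lose one, and row 0 can always gain one. *)
Lemma size_add_box la : is_partition la -> size (add_box la) = (size (removable la)).+1.
Proof.
move=> pla; rewrite add_boxE // size_map /addable /=; congr _.+1.
by rewrite -[1]addn0 iotaDl filter_map size_map.
Qed.

(** A row of length 1 that loses its box must disappear from the list; when it is removable it is
    the last row, so truncation does this. *)
Definition decr_nth la i :=
  if nth 0 la i == 1 then take i la else set_nth 0 la i (nth 0 la i).-1.

Lemma nth_decr_nth la i j : is_partition la -> i \in removable la ->
  nth 0 (decr_nth la i) j = nth 0 la j - (i == j).
Proof.
move=> pla; have /is_partitionP[dec pos] := pla.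
rewrite mem_filter mem_iota /= add0n => /andP[lt il]; rewrite /decr_nth.
case: eqP => [e1|ne1]; last first.
  rewrite nth_set_nth /= eq_sym; case: eqP => [->|]; rewrite ?subn0 ?subn1 //.
case: (ltngtP i j) => [ij|ji|<-]; last by rewrite e1 nth_default // size_take il.
  rewrite subn0 nth_default ?size_take ?il; last exact: ltnW.
  by have := partition_nth pla ij; lia.
by rewrite subn0 nth_take.
Qed.

Lemma decr_nth_partition la i : is_partition la -> i \in removable la ->
  is_partition (decr_nth la i).
Proof.
move=> pla ir; have /is_partitionP[dec pos] := pla.
have nthE j := nth_decr_nth j pla ir.
apply/is_partitionP; split=> j; rewrite !nthE.
  move: ir; rewrite mem_filter => /andP[lt _].
  by have := dec j; case: (eqVneq i j) => [ij|_]; [rewrite -ij|]; lia.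
move: ir; rewrite mem_filter mem_iota /= add0n => /andP[lt il].
rewrite /decr_nth; case: eqP => [e1|ne1].
  by rewrite size_take il => ji; have := pos j; lia.
rewrite size_set_nth (maxn_idPr il) => jl.
by have := pos j jl; case: eqP => [<-|_]; lia.
Qed.

Lemma incr_decr_nth la i : is_partition la -> i \in removable la ->
  incr_nth (decr_nth la i) i = la.
Proof.
move=> pla ir; have nthE j := nth_decr_nth j pla ir.
have /is_partitionP[dec pos] := pla.
have ir' := ir; move: ir'; rewrite mem_filter mem_iota /= add0n => /andP[lt il].
have nu_il : i <= size (decr_nth la i).
  by rewrite /decr_nth; case: eqP => _; rewrite ?size_take ?il // size_set_nth leq_max ltnW ?orbT // ltnW.
have pnu := decr_nth_partition pla ir.
apply: partition_eq => // [|j]; last first.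
  by rewrite nth_incr_nth nthE; case: eqP => [<-|_] /=; lia.
rewrite is_partition_incr // !nthE eqxx; case: i {ir nthE nu_il pnu} lt il => //= i lt il.
by rewrite (gtn_eqF (ltnSn i)) subn0; have := dec i; lia.
Qed.

Lemma add_box_partition la mu : mu \in add_box la ->
  is_partition mu /\ sumn mu = (sumn la).+1.
Proof. by case/add_boxP => i _ [-> pm]; rewrite sumn_incr_nth. Qed.

Lemma decr_nth_add_box la i : is_partition la -> i \in removable la ->
  la \in add_box (decr_nth la i).
Proof.
move=> pla ir; apply/add_boxP; exists i; last by rewrite incr_decr_nth.
move: ir; rewrite mem_filter mem_iota /= add0n => /andP[lt il].
by rewrite /decr_nth; case: eqP => _; rewrite ?size_take ?il // size_set_nth leq_max ltnW ?orbT // ltnW.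
Qed.

Lemma add_box_decr_nth la nu : is_partition nu -> la \in add_box nu ->
  exists2 i, i \in removable la & nu = decr_nth la i.
Proof.
move=> pnu /add_boxP[i il [e pla]]; have /is_partitionP[dec _] := pnu.
have nthE j : nth 0 la j = (i == j) + nth 0 nu j by rewrite e nth_incr_nth.
have ir : i \in removable la.
  rewrite mem_filter mem_iota /= !nthE eqxx (ltn_eqF (ltnSn i)) add0n add1n ltnS dec /=.
  by rewrite e size_incr_nth; case: ifP.
exists i => //; apply: partition_eq => // [|j]; first exact: decr_nth_partition.
by rewrite nth_decr_nth // nthE addKn.
Qed.

(** Partitions are grown box by box; [undup] is there because a partition arises once for each of
    its removable boxes. *)
Fixpoint partitions k : seq (seq nat) :=
  if k is k'.+1 then undup (flatten [seq add_box la | la <- partitions k']) else [:: [::]].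

Lemma partitions_uniq k : uniq (partitions k).
Proof. by case: k => [|k]; [|apply: undup_uniq]. Qed.

Lemma mem_partitions k la : (la \in partitions k) = partition_of k la.
Proof.
elim: k la => [|k IH] la.
  rewrite inE; apply/eqP/andP => [->|[pla /eqP s0]] //.
  case: la pla s0 => //= x la /andP[_]; rewrite inE negb_or => /andP[x0 _].
  by case: x x0.
rewrite mem_undup; apply/flatten_mapP/andP => [[nu]|[pla /eqP sla]].
  rewrite IH => /andP[pnu /eqP snu] /add_box_partition[-> ->].
  by rewrite snu.
have /is_partitionP[dec pos] := pla.
have sz : 0 < size la by case: (la) sla.
(* The last row can always lose a box, since the row below it reads as 0. *)
have ir : (size la).-1 \in removable la.
  rewrite mem_filter mem_iota /= add0n prednK // leqnn andbT.
  by rewrite [X in X < _]nth_default // pos // prednK.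
exists (decr_nth la (size la).-1); last exact: decr_nth_add_box.
rewrite IH /partition_of decr_nth_partition //=.
by rewrite -eqSS -(sumn_incr_nth _ (size la).-1) incr_decr_nth // sla.
Qed.

Lemma size_partitions_removable k la : partition_of k.+1 la ->
  size [seq nu <- partitions k | la \in add_box nu] = size (removable la).
Proof.
case/andP=> pla /eqP sla; rewrite -[RHS](size_map (decr_nth la)).
apply/perm_size/uniq_perm; first by rewrite filter_uniq ?partitions_uniq.
  rewrite map_inj_in_uniq ?filter_uniq ?iota_uniq // => i j ir jr e.
  by apply: (@incr_nth_inj (decr_nth la i)); rewrite {2}e !incr_decr_nth.
move=> nu; rewrite mem_filter mem_partitions; apply/andP/mapP => [[lanu /andP[pnu _]]|[i ir ->]].
  exact: add_box_decr_nth.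
rewrite decr_nth_add_box // /partition_of decr_nth_partition //=.
by rewrite -eqSS -(sumn_incr_nth _ i) incr_decr_nth // sla.
Qed.

End Partitions.

Arguments partitions : simpl never.

Import Order.TTheory GRing.Theory Num.Theory.
Local Open Scope ring_scope.
Local Open Scope sesquilinear_scope.

(** * The group algebra and its trace *)

Section GroupAlgebraTrace.

Variables (C : numClosedFieldType) (gT : finGroupType).
Local Notation G := [set: gT]%G.
Local Notation GA := 'M[C]_#|G|.
Implicit Types (g h s : gT) (M N : GA) (H K : {group gT}).

Definition rho g : GA := regular_repr C G g.
(* On the group algebra [tau] is the coefficient of the identity. *)
Definition tau M : C := #|G|%:R^-1 * \tr M.
(** Group elements act by permutation matrices, so on the group ring the conjugate transpose is the
    antilinear involution inverting group elements. *)
Definition star M : GA := M ^t*.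
Definition group_coef M g : C := tau (M * rho g^-1).

Lemma mulZl a M N : (a *: M) * N = a *: (M * N).
Proof. by rewrite -!mulmxE scalemxAl. Qed.

Lemma mulZr a M N : M * (a *: N) = a *: (M * N).
Proof. by rewrite -!mulmxE scalemxAr. Qed.

Lemma rhoM g h : rho (g * h)%g = rho g * rho h.
Proof. by rewrite /rho repr_mxM ?inE. Qed.

Lemma rho1 : rho 1%g = 1.
Proof. by rewrite /rho repr_mx1. Qed.

Lemma rhoVK g : rho g^-1 * rho g = 1.
Proof. by rewrite -rhoM mulVg rho1. Qed.

Lemma rhoKV g : rho g * rho g^-1 = 1.
Proof. by rewrite -rhoM mulgV rho1. Qed.

Lemma tau_is_linear : linear_for *%R tau.
Proof. by move=> a M N; rewrite /tau linearD linearZ /= mulrDr mulrCA. Qed.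
HB.instance Definition _ := GRing.isLinear.Build C GA C *%R tau tau_is_linear.

Lemma tauC M N : tau (M * N) = tau (N * M).
Proof. by rewrite /tau mxtrace_mulC. Qed.

Lemma rhoE g (i j : 'I_#|G|) :
  rho g i j = (enum_val j == enum_val i * g)%g%:R.
Proof.
rewrite /rho /= mxE /delta_mx mxE eqxx /=; congr (_%:R).
by rewrite -{1}(gring_valK j) (can_in_eq (gring_indexK (G := G))) ?inE.
Qed.

Lemma card_neq0 : #|G|%:R != 0 :> C.
Proof. by rewrite pnatr_eq0 -lt0n cardG_gt0. Qed.

(** Right translation by a nontrivial element moves every basis vector, so its diagonal is zero. *)
Lemma tau_rho g : tau (rho g) = (g == 1%g)%:R.
Proof.
rewrite /tau /mxtrace (eq_bigr (fun _ => (g == 1%g)%:R)) => [|i _]; last first.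
  by rewrite rhoE -{1}[enum_val i]mulg1 (inj_eq (mulgI _)) eq_sym.
by rewrite sumr_const card_ord -[X in _ * X]mulr_natr mulrCA mulVf ?mulr1 ?card_neq0.
Qed.

Lemma starD M N : star (M + N) = star M + star N.
Proof. by rewrite /star linearD /= map_mxD. Qed.

Lemma starZ a M : star (a *: M) = a^* *: star M.
Proof. by rewrite /star linearZ /= map_mxZ. Qed.

Lemma star0 : star 0 = 0.
Proof. by rewrite /star linear0 map_mx0. Qed.

Lemma starM M N : star (M * N) = star N * star M.
Proof. by rewrite /star trmx_mul map_mxM. Qed.

Lemma star_sum I (r : seq I) (P : pred I) (F : I -> GA) :
  star (\sum_(i <- r | P i) F i) = \sum_(i <- r | P i) star (F i).
Proof. exact: (big_morph star starD star0). Qed.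

Lemma starK : involutive star.
Proof. by move=> M; rewrite /star trmxCK. Qed.

Lemma star_rho g : star (rho g) = rho g^-1.
Proof.
apply/matrixP=> i j; rewrite [LHS]mxE mxE !rhoE conjC_nat eq_sym; congr (_%:R).
by rewrite (can2_eq (mulgK g) (mulgKV g)) eq_sym.
Qed.

Lemma tau_starE M :
  tau (M * star M) = #|G|%:R^-1 * \sum_i \sum_j `|M i j| ^+ 2.
Proof.
rewrite /tau /mxtrace; congr (_ * _); apply: eq_bigr => i _.
by rewrite mxE; apply: eq_bigr => j _; rewrite !mxE normCK.
Qed.

Lemma tau_star_ge0 M : 0 <= tau (M * star M).
Proof.
rewrite tau_starE mulr_ge0 ?invr_ge0 ?ler0n ?sumr_ge0 // => i _.
by rewrite sumr_ge0 // => j _; rewrite exprn_ge0.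
Qed.

(** Up to a positive factor this trace is the sum of the squared moduli of the entries. Faithfulness
    is what later turns trace computations into identities of elements. *)
Lemma tau_star_eq0 M : tau (M * star M) = 0 -> M = 0.
Proof.
rewrite tau_starE => /eqP; rewrite mulf_eq0 invr_eq0 (negPf card_neq0) /=.
have ge0 i : 0 <= \sum_j `|M i j| ^+ 2.
  by rewrite sumr_ge0 // => j _; rewrite exprn_ge0.
rewrite psumr_eq0 // => /allP M0; apply/matrixP=> i j; rewrite mxE.
have := M0 i (mem_index_enum _); rewrite /= psumr_eq0; last first.
  by move=> k _; rewrite exprn_ge0.
by move/allP/(_ j (mem_index_enum _)); rewrite /= expf_eq0 /= normr_eq0 => /eqP.
Qed.

(** A matrix of this size need not come from the group ring; the equation says that M does, with
    coefficients vanishing outside H. *)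
Definition supported (H : {set gT}) M := M = \sum_(s in H) group_coef M s *: rho s.

Lemma group_coef_sum (H : {set gT}) (f : gT -> C) g :
  group_coef (\sum_(s in H) f s *: rho s) g = if g \in H then f g else 0.
Proof.
rewrite /group_coef mulr_suml linear_sum /=.
rewrite (eq_bigr (fun s => f s * (s == g)%:R)) => [|s _]; last first.
  by rewrite mulZl linearZ /= -rhoM tau_rho -eq_mulgV1.
rewrite (bigID (pred1 g)) /= addrC big1 => [|s /andP[_ /negPf->]]; last first.
  by rewrite mulr0.
rewrite add0r; case: ifP => gH.
  by rewrite (big_pred1 g) ?eqxx ?mulr1 // => s /=; case: eqP => [->|]; rewrite ?gH ?andbF.
by rewrite big1 // => s /andP[sH /eqP sg]; rewrite sg gH in sH.
Qed.

Lemma group_coefD M N g : group_coef (M + N) g = group_coef M g + group_coef N g.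
Proof. by rewrite /group_coef mulrDl linearD. Qed.

Lemma group_coefZ a M g : group_coef (a *: M) g = a * group_coef M g.
Proof. by rewrite /group_coef mulZl linearZ. Qed.

Lemma group_coef_bigsum I (r : seq I) (P : pred I) (F : I -> GA) g :
  group_coef (\sum_(i <- r | P i) F i) g = \sum_(i <- r | P i) group_coef (F i) g.
Proof. by rewrite /group_coef mulr_suml linear_sum. Qed.

Lemma supported_sum (H : {set gT}) (f : gT -> C) :
  supported H (\sum_(s in H) f s *: rho s).
Proof. by apply: eq_bigr => s sH; rewrite group_coef_sum sH. Qed.

Lemma supportedP (H : {set gT}) M :
  supported H M <-> exists f : gT -> C, M = \sum_(s in H) f s *: rho s.
Proof. by split=> [->|[f ->]]; [exists (group_coef M) | apply: supported_sum]. Qed.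

Lemma supported0 (H : {set gT}) : supported H 0.
Proof. by apply/supportedP; exists (fun=> 0); rewrite big1 // => s _; rewrite scale0r. Qed.

Lemma supportedD (H : {set gT}) M N : supported H M -> supported H N -> supported H (M + N).
Proof.
move=> -> ->; apply/supportedP; exists (fun s => group_coef M s + group_coef N s).
by rewrite -big_split; apply: eq_bigr => s _; rewrite scalerDl.
Qed.

Lemma supportedZ (H : {set gT}) a M : supported H M -> supported H (a *: M).
Proof.
move=> ->; apply/supportedP; exists (fun s => a * group_coef M s).
by rewrite scaler_sumr; apply: eq_bigr => s _; rewrite scalerA.
Qed.

Lemma supported_rho (H : {set gT}) g : g \in H -> supported H (rho g).
Proof.
move=> gH; apply/supportedP; exists (fun s => (s == g)%:R).
rewrite (bigD1 g) //= eqxx scale1r big1 ?addr0 // => s /andP[_ /negPf->].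
by rewrite scale0r.
Qed.

Lemma supported_big I (r : seq I) (P : pred I) (F : I -> GA) (H : {set gT}) :
  (forall i, P i -> supported H (F i)) -> supported H (\sum_(i <- r | P i) F i).
Proof. by move=> sF; apply: big_ind => //; [apply: supported0 | apply: supportedD]. Qed.

Lemma supportedS (H K : {set gT}) M : H \subset K -> supported H M -> supported K M.
Proof.
move=> sHK ->; apply: supported_big => s sH.
by apply: supportedZ; apply: supported_rho; apply: (subsetP sHK).
Qed.

Lemma supportedM H M N : supported H M -> supported H N -> supported H (M * N).
Proof.
move=> -> ->; rewrite mulr_suml; apply: supported_big => s sH.
rewrite mulr_sumr; apply: supported_big => t tH.
rewrite mulZl mulZr -rhoM; do 2!apply: supportedZ.
by apply: supported_rho; rewrite groupM.
Qed.

Lemma supported_eq (H : {set gT}) M N : supported H M -> supported H N ->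
  (forall g, g \in H -> group_coef M g = group_coef N g) -> M = N.
Proof. by move=> sM sN eqMN; rewrite sM sN; apply: eq_bigr => s sH; rewrite eqMN. Qed.

Lemma group_coef_supp (H : {set gT}) M g : supported H M -> g \notin H -> group_coef M g = 0.
Proof. by move=> sM /negPf gH; rewrite sM group_coef_sum gH. Qed.

(** The identity coefficient of a product pairs s with its inverse, so only elements common to both
    supports contribute. *)
Lemma tauM_supported (H K : {set gT}) M N : supported H M -> supported K N ->
  (forall s, s \in K -> s^-1%g \in K) ->
  tau (M * N) = \sum_(s in H :&: K) group_coef M s * group_coef N s^-1%g.
Proof.
move=> sM sN KV; rewrite {1}sM mulr_suml linear_sum /= (bigID (mem K)) /=.
rewrite [X in _ + X]big1 ?addr0 => [|s /andP[_ sK]]; last first.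
  rewrite mulZl linearZ /= tauC.
  have -> : tau (N * rho s) = group_coef N s^-1%g by rewrite /group_coef invgK.
  rewrite (group_coef_supp sN) ?mulr0 //; apply: contra sK => /KV.
  by rewrite invgK.
apply: eq_big => s; first by rewrite !inE.
by move=> _; rewrite mulZl linearZ /= tauC /group_coef invgK.
Qed.

(* An idempotent matrix factors as C R with R C = 1. *)
Lemma mxtrace_idempotent n (P : 'M[C]_n) : P *m P = P -> \tr P = (\rank P)%:R.
Proof.
move=> PP; have RC : row_base P *m col_base P = 1%:M.
  apply: (row_full_inj (col_base_full P)); apply: (row_free_inj (row_base_free P)).
  by rewrite mulmx1 mulmx_base mulmxA mulmx_base -mulmxA mulmx_base PP.
by rewrite -[in LHS](mulmx_base P) mxtrace_mulC RC mxtrace1.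
Qed.

End GroupAlgebraTrace.

(** * Tableaux *)

Section Tableaux.

Variables (T : finType) (X : {set T}).
Implicit Types (h r c : T -> nat) (s x p q : {perm T}).

Lemma Sym_in s y : s \in Sym X -> (s y \in X) = (y \in X).
Proof. by rewrite inE => /perm_closed. Qed.

Lemma Sym_out s y : s \in Sym X -> y \notin X -> s y = y.
Proof. by rewrite inE => /out_perm; apply. Qed.

(** Here h is the row function or the column function of a filling. Arbitrary fillings are allowed
    because tableaux extending a smaller one are needed besides the canonical tableau. *)
Definition stab h := [set s in Sym X | [forall y in X, h (s y) == h y]].

Lemma stabP h s : reflect (s \in Sym X /\ forall y, h (s y) = h y) (s \in stab h).
Proof.
rewrite [_ \in stab h]inE; apply: (iffP andP) => -[sX hs]; split=> //.
  move=> y; case: (boolP (y \in X)) => [yX|/(Sym_out sX)->//].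
  by apply/eqP; move/forall_inP: hs; apply.
by apply/forall_inP => y _; rewrite hs.
Qed.

Lemma stab_group_set h : group_set (stab h).
Proof.
apply/group_setP; split=> [|s t /stabP[sX hs] /stabP[tX ht]].
  by apply/stabP; split=> [|y]; rewrite ?group1 ?perm1.
by apply/stabP; split=> [|y]; rewrite ?groupM // permM ht hs.
Qed.
Canonical stab_group h := Group (stab_group_set h).

Lemma stab_Sym h s : s \in stab h -> s \in Sym X.
Proof. by case/stabP. Qed.

Lemma tperm_Sym y z : y \in X -> z \in X -> tperm y z \in Sym X.
Proof.
move=> yX zX; rewrite inE; apply/subsetP => w; rewrite inE.
by apply: contraR => wX; rewrite tpermD //; apply: contraNneq wX => <-.
Qed.

Lemma tperm_stab h y z : y \in X -> z \in X -> h y = h z -> tperm y z \in stab h.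
Proof.
move=> yX zX hyz; apply/stabP; split=> [|w]; first exact: tperm_Sym.
by case: tpermP => // ->.
Qed.

(** Choosing for each y in X a point z with [psi z = phi y] is injective because [phi] is, so
    together with the identity outside X it is a permutation. *)
Lemma perm_extend (K : eqType) (phi psi : T -> K) : {in X &, injective phi} ->
    (forall y, y \in X -> exists2 z, z \in X & psi z = phi y) ->
  exists2 s, s \in Sym X & {in X, forall y, psi (s y) = phi y}.
Proof.
move=> phi_inj psi_phi.
pose f y := if y \in X then odflt y [pick z in X | psi z == phi y] else y.
have fX y : y \in X -> f y \in X /\ psi (f y) = phi y.
  rewrite /f => yX; rewrite yX; case: pickP => [z /andP[zX /eqP//]|/= no].
  by have [z zX e] := psi_phi y yX; have := no z; rewrite zX e eqxx.
have fN y : y \notin X -> f y = y by rewrite /f => /negPf->.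
have f_inj : injective f.
  move=> y z efyz; case: (boolP (y \in X)) (boolP (z \in X)) => yX [] zX.
  - by apply: phi_inj => //; rewrite -(fX y yX).2 -(fX z zX).2 efyz.
  - by have [] := fX y yX; rewrite efyz fN // (negPf zX).
  - by have [] := fX z zX; rewrite -efyz fN // (negPf yX).
  by rewrite -(fN y yX) -(fN z zX).
exists (perm f_inj) => [|y yX]; last by rewrite permE; case: (fX y yX).
rewrite inE; apply/subsetP => y; rewrite inE permE.
by apply: contraR => /fN->.
Qed.

Lemma card_split c (P : pred T) :
  #|[set y in X | P y]| =
  (\sum_(j < (\max_(y in X) c y).+1) #|[set y in X | (c y == j) && P y]|)%N.
Proof.
rewrite -sum1_card (partition_big (fun y => inord (c y) : 'I_(\max_(y in X) c y).+1) xpredT) //=.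
apply: eq_bigr => j _; rewrite -sum1_card; apply: eq_bigl => y.
rewrite !inE -andbA; case: (boolP (y \in X)) => //= yX.
rewrite andbC; congr (_ && _); rewrite -val_eqE /= inordK //.
by rewrite ltnS (leq_bigmax_cond (F := c)).
Qed.

(** * Comparing two row functions column by column *)

Section Columns.

Variables r c r' : T -> nat.
Hypothesis col_down : forall y m, y \in X -> (m <= r y)%N ->
  exists2 z, z \in X & r z = m /\ c z = c y.
Hypothesis col_inj : {in X &, injective (fun y => (r' y, c y))}.

(** If column j reaches row m under [r], it has entries in all rows below m, hence at least m of
    them, while [r'] is injective on the column and gives at most m. Otherwise every entry of the
    column is counted on the right. *)
Lemma col_card_le j m : (#|[set y in X | (c y == j) && (r' y < m)]| <=
  #|[set y in X | (c y == j) && (r y < m)]|)%N.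
Proof.
case: (boolP [exists y in X, (c y == j) && (m <= r y)%N]).
  case/exists_inP => y yX /andP[/eqP cy mr]; apply: (@leq_trans m).
    rewrite cardE -(size_map r') -[leqRHS](size_iota 0); apply: uniq_leq_size.
      rewrite map_inj_in_uniq ?enum_uniq // => u v; rewrite !mem_enum !inE.
      case/and3P=> uX /eqP cu _ /and3P[vX /eqP cv _] ruv.
      by apply: col_inj => //; rewrite cu cv ruv.
    move=> i /mapP[u]; rewrite mem_enum inE => /and3P[_ _ um] ->.
    by rewrite mem_iota.
  rewrite cardE -(size_map r) -[leqLHS](size_iota 0).
  apply: uniq_leq_size; first exact: iota_uniq.
  move=> i; rewrite mem_iota /= add0n => im.
  have [z zX [rz cz]] := col_down yX (leq_trans (ltnW im) mr).
  by apply/mapP; exists z => //; rewrite mem_enum inE zX cz cy eqxx rz im.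
move/exists_inPn => no; apply/subset_leq_card/subsetP => y.
rewrite !inE => /and3P[yX cy _]; rewrite yX cy /= ltnNge.
by have := no y yX; rewrite cy.
Qed.

Lemma row_card_le m : (#|[set y in X | r' y < m]| <= #|[set y in X | r y < m]|)%N.
Proof.
rewrite (card_split c (fun y => r' y < m)%N) (card_split c (fun y => r y < m)%N).
by apply: leq_sum => j _; apply: col_card_le.
Qed.

(** Equality of the total counts forces equality in each column, as the columnwise counts are
    already comparable. Then [r] and [r'] take the same values on each column, and a column
    permutation matches them. *)
Lemma col_match :
  (forall m, #|[set y in X | r' y < m]| = #|[set y in X | r y < m]|)%N ->
  exists2 q, q \in stab c & {in X, forall y, r (q y) = r' y}.
Proof.
move=> eq_rows.
have eq_cols y m : y \in X -> #|[set z in X | (c z == c y) && (r' z < m)%N]| =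
                 #|[set z in X | (c z == c y) && (r z < m)%N]|.
  move=> yX; have := eq_rows m.
  rewrite (card_split c (fun y => r' y < m)%N) (card_split c (fun y => r y < m)%N).
  move/eqP; have ltj : (c y < (\max_(y in X) c y).+1)%N.
    by rewrite ltnS (leq_bigmax_cond (F := c)).
  have [_ ->] := leqif_sum (P := xpredT)
    (fun (j : 'I_(\max_(y in X) c y).+1) _ => leqif_eq (col_card_le j m)).
  by move/forall_inP/(_ (Ordinal ltj) isT)/eqP.
have [||q qX rq] := @perm_extend _ (fun y => (r' y, c y)) (fun y => (r y, c y)).
- exact: col_inj.
- move=> y yX.
  (* In the column of y the count jumps at height [r' y], because y itself is counted there under
     [r']; hence some entry of the column has that value under [r]. *)
  have : (#|[set z in X | (c z == c y) && (r z < r' y)]| <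
          #|[set z in X | (c z == c y) && (r z < (r' y).+1)]|)%N.
    rewrite -!eq_cols //; apply: proper_card; apply/properP; split.
      apply/subsetP => z; rewrite !inE => /and3P[-> -> /= ?]; exact: ltnW.
    by exists y; rewrite !inE yX eqxx ?ltnn //= ltnSn.
  rewrite ltnNge => /negP no; case: (boolP [exists z in X, (r z == r' y) && (c z == c y)]).
    by case/exists_inP=> z zX /andP[/eqP rz /eqP cz]; exists z; rewrite // rz cz.
  move/exists_inPn => none; case: no; apply/subset_leq_card/subsetP => z.
  rewrite !inE => /and3P[zX cz]; rewrite zX cz /= ltnS leq_eqVlt.
  by have := none z zX; rewrite cz andbT => /negPf->.
exists q; last by move=> y /rq[].
by apply/stabP; split=> // y; case: (boolP (y \in X)) => [/rq[]//|/(Sym_out qX)->].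
Qed.

End Columns.

(** Together the clauses make y |-> (r y, c y) a bijection from X onto the cells of the diagram of
    [la]. *)
Definition tableau (la : seq nat) r c :=
  [/\ {in X &, injective (fun y => (r y, c y))},
      forall y, y \in X -> (c y < nth 0%N la (r y))%N
    & forall i j, (j < nth 0%N la i)%N -> exists2 y, y \in X & r y = i /\ c y = j].

Lemma tableau_down la r c : is_partition la -> tableau la r c ->
  forall y m, y \in X -> (m <= r y)%N -> exists2 z, z \in X & r z = m /\ c z = c y.
Proof.
move=> pla [_ cl ex] y m yX my; apply: ex; apply: leq_trans (cl y yX) _.
exact: partition_nth.
Qed.

Lemma tableau_row_card la r c i : tableau la r c ->
  #|[set y in X | r y == i]| = nth 0%N la i.
Proof.
case=> inj cl ex; rewrite cardE -(size_map c) -[RHS](size_iota 0).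
apply/perm_size/uniq_perm; rewrite ?iota_uniq //.
  rewrite map_inj_in_uniq ?enum_uniq // => u v; rewrite !mem_enum !inE.
  case/andP=> uX /eqP ru /andP[vX /eqP rv] cuv.
  by apply: inj => //; rewrite ru rv cuv.
move=> j; rewrite mem_iota /= add0n; apply/mapP/idP.
  by case=> y; rewrite mem_enum inE => /andP[yX /eqP<-] ->; apply: cl.
by case/ex=> y yX [ry cy]; exists y; rewrite // mem_enum inE yX ry eqxx.
Qed.

(** Each row length is the difference of two consecutive counts. *)
Lemma tableau_shape la la' r c r' c' : is_partition la -> is_partition la' ->
    tableau la r c -> tableau la' r' c' ->
    (forall m, #|[set y in X | r' y < m]| = #|[set y in X | r y < m]|)%N ->
  la = la'.
Proof.
move=> pla pla' tla tla' eqm.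
have eqn i : nth 0%N la i = nth 0%N la' i.
  rewrite -(tableau_row_card i tla) -(tableau_row_card i tla').
  have split_row (g : T -> nat) : #|[set y in X | g y < i.+1]|%N =
      (#|[set y in X | g y < i]| + #|[set y in X | g y == i]|)%N.
    rewrite -cardsUI [X in (_ + X)%N](_ : _ = 0%N); last first.
      apply/eqP; rewrite cards_eq0 -subset0; apply/subsetP => y.
      by rewrite !inE; case: ltngtP; rewrite ?andbF.
    rewrite addn0; apply: eq_card => y; rewrite !inE -andb_orr ltnS leq_eqVlt orbC //.
  by apply/eqP; rewrite -(eqn_add2l #|[set y in X | r y < i]|%N) -split_row -!eqm -split_row.
exact: partition_eq eqn.
Qed.

Lemma tableau_conj la r c r' c' : tableau la r c -> tableau la r' c' ->
  exists2 s, s \in Sym X & {in X, forall y, r (s y) = r' y /\ c (s y) = c' y}.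
Proof.
move=> [inj cl ex] [inj' cl' ex'].
have [|y yX|s sX es] := @perm_extend _ (fun y => (r' y, c' y)) (fun y => (r y, c y)).
- exact: inj'.
- by have [z zX [rz cz]] := ex _ _ (cl' y yX); exists z; rewrite // rz cz.
by exists s => // y /es[].
Qed.

Lemma canonical_tableau la : sumn la = #|X| ->
  tableau la (tableau_row la X) (tableau_col la X).
Proof.
move=> sla; have lt y : y \in X -> (index y (enum X) < sumn la)%N.
  by rewrite sla cardE index_mem mem_enum.
split.
- move=> y z yX zX [/= er ec].
  rewrite -[y](nth_index y (s := enum X)) ?mem_enum //.
  rewrite -[index _ _](reshape_indexK la).
  rewrite -/(tableau_row la X y) -/(tableau_col la X y) er ec.
  by rewrite /tableau_row /tableau_col reshape_indexK nth_index ?mem_enum.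
- by move=> y /lt; apply: reshape_offsetP.
move=> i j lj.
have il : (i < size la)%N by rewrite ltnNge; apply/negP => /(nth_default 0%N) e; rewrite e in lj.
have ltf : (flatten_index la i j < size (enum X))%N.
  rewrite -cardE -sla /flatten_index -{2}(cat_take_drop i la) sumn_cat ltn_add2l.
  by rewrite (drop_nth 0%N il) /= ltn_addr.
have x0 : T by case: (enum X) ltf => [|y] //.
exists (nth x0 (enum X) (flatten_index la i j)).
  by rewrite -mem_enum mem_nth.
by rewrite /tableau_row /tableau_col index_uniq ?enum_uniq // flatten_indexKl ?flatten_indexKr.
Qed.

End Tableaux.

(** * Young symmetrizers *)

Section Conjugation.

Variables (C : numClosedFieldType) (gT : finGroupType).
Local Notation GA := 'M[C]_#|[set: gT]%G|.
Local Notation rho := (@rho C gT).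
Implicit Types (M N : GA) (x y : gT) (H : {group gT}).

Definition conjr x M := rho x^-1 * M * rho x.

Lemma conjr_is_linear x : linear (conjr x).
Proof. by move=> a M N; rewrite /conjr mulrDr mulrDl mulZr mulZl. Qed.
HB.instance Definition _ x :=
  GRing.isLinear.Build C GA GA *:%R (conjr x) (conjr_is_linear x).

Lemma conjrM x M N : conjr x (M * N) = conjr x M * conjr x N.
Proof. by rewrite /conjr !mulrA -[_ * rho x * _]mulrA rhoKV mulr1. Qed.

Lemma conjr_comp x y M : conjr (x * y) M = conjr y (conjr x M).
Proof. by rewrite /conjr invMg !rhoM !mulrA. Qed.

Lemma conjr_rho x y : conjr x (rho y) = rho (y ^ x).
Proof. by rewrite /conjr -!rhoM /conjg mulgA. Qed.

Lemma star_conjr x M : star (conjr x M) = conjr x (star M).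
Proof. by rewrite /conjr !starM !star_rho invgK mulrA. Qed.

Lemma tau_conjr x M : tau (conjr x M) = tau M.
Proof. by rewrite /conjr tauC mulrA rhoKV mul1r. Qed.

Lemma conjr_fixP x M : conjr x M = M <-> M * rho x = rho x * M.
Proof.
split=> [fx|e]; last by rewrite /conjr -mulrA e mulrA rhoVK mul1r.
by rewrite -{2}fx /conjr !mulrA rhoKV mul1r.
Qed.

(** Invariance under conjugation by H only; M may have support outside H, as when an element of a
    larger symmetric group is compared with a subgroup. *)
Definition central H M := forall x, x \in H -> conjr x M = M.

Lemma centralC H M N : central H M -> supported H N -> M * N = N * M.
Proof.
move=> cM ->; rewrite mulr_sumr mulr_suml; apply: eq_bigr => x xH.
by rewrite mulZr mulZl; congr (_ *: _); apply/conjr_fixP/cM.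
Qed.

Lemma centralZ H a M : central H M -> central H (a *: M).
Proof. by move=> cM x xH; rewrite linearZ /= cM. Qed.

Definition conj_sum H M := \sum_(x in H) conjr x M.

Lemma conj_sum_is_linear H : linear (conj_sum H).
Proof.
move=> a M N; rewrite /conj_sum scaler_sumr -big_split.
by apply: eq_bigr => x _; rewrite linearP.
Qed.
HB.instance Definition _ H :=
  GRing.isLinear.Build C GA GA *:%R (conj_sum H) (conj_sum_is_linear H).

Lemma conj_sum_central H M : central H (conj_sum H M).
Proof.
move=> y yH; rewrite /conj_sum linear_sum [RHS](reindex_inj (mulIg y)).
by apply: eq_big => [x|x _]; rewrite ?groupMr ?conjr_comp.
Qed.

Lemma supported_conjr H x M : supported H M -> x \in H -> supported H (conjr x M).
Proof.
by move=> sM xH; apply: supportedM; [apply: supportedM => //|]; apply: supported_rho; rewrite ?groupV.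
Qed.

Lemma supported_conj_sum H M : supported H M -> supported H (conj_sum H M).
Proof. by move=> sM; apply: supported_big => x xH; apply: supported_conjr. Qed.

(** For M a group element y of H, the two products are conjugate under y, and the shift by y is
    absorbed by the sum; linearity in M does the rest. *)
Lemma conj_sum_mulC H M N : supported H M -> conj_sum H (M * N) = conj_sum H (N * M).
Proof.
move=> ->; rewrite mulr_suml mulr_sumr !linear_sum; apply: eq_bigr => y yH.
rewrite mulZl mulZr !linearZ; congr (_ *: _).
rewrite [RHS]/(conj_sum H _) (reindex_inj (mulgI y^-1%g)) /=.
apply: eq_big => [x|x _]; first by rewrite groupMl ?groupV.
by rewrite conjr_comp /conjr invgK !mulrA -[_ * rho y * rho _]mulrA rhoKV mulr1.
Qed.

Lemma tau_conj_sum H M : tau (conj_sum H M) = #|H|%:R * tau M.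
Proof.
rewrite /conj_sum linear_sum /= (eq_bigr (fun=> tau M)) => [|x _]; last exact: tau_conjr.
by rewrite sumr_const mulr_natl.
Qed.

Lemma star_conj_sum H M : star (conj_sum H M) = conj_sum H (star M).
Proof. by rewrite star_sum; apply: eq_bigr => x _; rewrite star_conjr. Qed.

Lemma mul_conj_sum_central H M N : central H N -> conj_sum H M * N = conj_sum H (M * N).
Proof.
move=> cN; rewrite mulr_suml; apply: eq_bigr => x xH.
by rewrite conjrM (cN x xH).
Qed.

End Conjugation.

(** * Row sums, signed column sums and their products *)

Section YoungElements.

Variables (C : numClosedFieldType) (T : finType).
Local Notation GA := 'M[C]_#|[set: {perm T}]%G|.
Local Notation rho := (@rho C {perm T}).
Implicit Types (X Y : {set T}) (h r c : T -> nat) (s x : {perm T}) (M N : GA).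

Definition row_sum X h : GA := \sum_(p in stab X h) rho p.
Definition col_altsum X h : GA := \sum_(q in stab X h) (-1) ^+ (odd_perm q) *: rho q.

Lemma row_sum_mull X h p : p \in stab X h -> rho p * row_sum X h = row_sum X h.
Proof.
move=> pS; rewrite /row_sum mulr_sumr [RHS](reindex_inj (mulgI p)) /=.
by apply: eq_big => [q|q _]; rewrite ?groupMl ?rhoM.
Qed.

Lemma col_altsum_mulr X h q : q \in stab X h ->
  col_altsum X h * rho q = (-1) ^+ (odd_perm q) *: col_altsum X h.
Proof.
move=> qS; rewrite /col_altsum mulr_suml scaler_sumr [RHS](reindex_inj (mulIg q)) /=.
apply: eq_big => [p|p _]; first by rewrite groupMr.
by rewrite mulZl scalerA -rhoM odd_permM signr_addb mulrCA -signr_addb addbb mulr1.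
Qed.

Lemma star_row_sum X h : star (row_sum X h) = row_sum X h.
Proof.
rewrite /row_sum star_sum [RHS](reindex_inj invg_inj) /=.
by apply: eq_big => [p|p _]; rewrite ?groupV ?star_rho.
Qed.

Lemma star_col_altsum X h : star (col_altsum X h) = col_altsum X h.
Proof.
rewrite /col_altsum star_sum [RHS](reindex_inj invg_inj) /=.
apply: eq_big => [p|p _]; rewrite ?groupV // odd_permV starZ star_rho.
by rewrite rmorphXn rmorphN rmorph1.
Qed.

Lemma row_sum_nest X h Y g : stab X h \subset stab Y g ->
  row_sum X h * row_sum Y g = #|stab X h|%:R *: row_sum Y g.
Proof.
move/subsetP=> sS; rewrite {1}/row_sum mulr_suml.
rewrite (eq_bigr (fun=> row_sum Y g)) => [|p /sS]; last exact: row_sum_mull.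
by rewrite sumr_const scaler_nat.
Qed.

Lemma col_altsum_nest X h Y g : stab X h \subset stab Y g ->
  col_altsum Y g * col_altsum X h = #|stab X h|%:R *: col_altsum Y g.
Proof.
move/subsetP=> sS; rewrite {2}/col_altsum mulr_sumr.
rewrite (eq_bigr (fun=> col_altsum Y g)) => [|p /sS pS]; last first.
  by rewrite mulZr col_altsum_mulr // scalerA -signr_addb addbb scale1r.
by rewrite sumr_const scaler_nat.
Qed.

Lemma supported_row_sum_stab X h : supported (stab X h) (row_sum X h).
Proof. by apply: supported_big => p pS; apply: supported_rho. Qed.

Lemma supported_col_altsum_stab X h : supported (stab X h) (col_altsum X h).
Proof. exact: supported_sum. Qed.

Lemma stab_sub X h : stab X h \subset Sym X.
Proof. by apply/subsetP => p; apply: stab_Sym. Qed.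

Lemma supported_row_sum X h : supported (Sym X) (row_sum X h).
Proof. exact: supportedS (stab_sub X h) (supported_row_sum_stab X h). Qed.

Lemma supported_col_altsum X h : supported (Sym X) (col_altsum X h).
Proof. exact: supportedS (stab_sub X h) (supported_col_altsum_stab X h). Qed.

Lemma tau_col_row X Y c r :
    (forall s, s \in stab X c -> s \in stab Y r -> s = 1%g) ->
  tau (col_altsum X c * row_sum Y r) = 1.
Proof.
move=> cr1; rewrite (tauM_supported (supported_col_altsum_stab X c) (supported_row_sum_stab Y r)); last first.
  by move=> s; rewrite groupV.
rewrite (big_pred1 1%g) => [|s]; last first.
  rewrite inE; apply/andP/eqP => [[sc sr]|->]; [exact: cr1 | by rewrite !group1].
rewrite invg1 /col_altsum group_coef_sum group1 odd_perm1 expr0 mul1r.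
rewrite /row_sum (eq_bigr (fun p => (fun=> 1) p *: rho p)) => [|p _]; last by rewrite scale1r.
by rewrite group_coef_sum group1.
Qed.

Lemma eq_stab X h h' : {in X, h =1 h'} -> stab X h = stab X h'.
Proof.
move=> e; apply/setP => s; rewrite [LHS]inE [RHS]inE; case: (boolP (s \in Sym X)) => //= sX.
by apply: eq_forallb_in => y yX; rewrite !e // (Sym_in y sX).
Qed.

Lemma eq_row_sum X h h' : {in X, h =1 h'} -> row_sum X h = row_sum X h'.
Proof. by move=> e; rewrite /row_sum (eq_stab e). Qed.

Lemma eq_col_altsum X h h' : {in X, h =1 h'} -> col_altsum X h = col_altsum X h'.
Proof. by move=> e; rewrite /col_altsum (eq_stab e). Qed.

Section Transport.

Variables (X Y : {set T}) (s : {perm T}).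
Hypothesis sXY : forall y, (s y \in Y) = (y \in X).

Lemma Sym_transport g : (g ^ s \in Sym Y)%g = (g \in Sym X).
Proof.
rewrite !inE; apply/subsetP/subsetP => sub y; rewrite inE => gy.
  rewrite -sXY; apply: sub; rewrite inE permJ.
  by rewrite (inj_eq perm_inj).
rewrite -(permKV s y) sXY; apply: sub; rewrite inE.
by apply: contra gy => /eqP e; rewrite -{1}(permKV s y) permJ e permKV.
Qed.

Lemma stab_transport h g : (g ^ s \in stab Y h)%g = (g \in stab X (h \o s)).
Proof.
apply/stabP/stabP; rewrite Sym_transport => -[gX gh]; split=> // y.
  by have := gh (s y); rewrite permJ.
by have := gh ((s^-1)%g y); rewrite /= permKV => <-; rewrite -{1}(permKV s y) permJ.
Qed.

Lemma row_sum_transport h : conjr s (row_sum X (h \o s)) = row_sum Y h.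
Proof.
rewrite /row_sum linear_sum [RHS](reindex_inj (conjg_inj s)) /=.
by apply: eq_big => [g|g _]; rewrite ?stab_transport ?conjr_rho.
Qed.

Lemma col_altsum_transport h : conjr s (col_altsum X (h \o s)) = col_altsum Y h.
Proof.
rewrite /col_altsum linear_sum [RHS](reindex_inj (conjg_inj s)) /=.
apply: eq_big => [g|g _]; rewrite ?stab_transport //.
by rewrite linearZ /= conjr_rho odd_permJ.
Qed.

Lemma tableau_transport la r c : tableau Y la r c -> tableau X la (r \o s) (c \o s).
Proof.
case=> inj cl ex; split.
- by move=> y z yX zX /inj e; apply: (@perm_inj _ s); apply: e; rewrite sXY.
- by move=> y yX; apply: cl; rewrite sXY.
move=> i j /ex[y yY [ry cy]]; exists ((s^-1)%g y); last by rewrite /= permKV.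
by rewrite -sXY permKV.
Qed.

Lemma conj_sum_transport M : conjr s (conj_sum (Sym_group X) M) = conj_sum (Sym_group Y) (conjr s M).
Proof.
rewrite /conj_sum linear_sum [RHS](reindex_inj (conjg_inj s)) /=.
apply: eq_big => [g|g _]; first by rewrite Sym_transport.
by rewrite -!conjr_comp conjgC.
Qed.

End Transport.

Section Symmetrizer.

Variables (X : {set T}) (la : seq nat) (r c : T -> nat).
Hypothesis tab : tableau X la r c.

Lemma row_col_trivial s : s \in stab X c -> s \in stab X r -> s = 1%g.
Proof.
case/stabP => sX sc /stabP[_ sr]; apply/permP => y; rewrite perm1.
case: (boolP (y \in X)) => [yX|/(Sym_out sX)//].
by case: tab => inj _ _; apply: inj; rewrite ?(Sym_in y sX) ?sr ?sc.
Qed.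

Lemma tau_young : tau (col_altsum X c * row_sum X r) = 1.
Proof. by apply: tau_col_row => s; apply: row_col_trivial. Qed.

End Symmetrizer.

(* If y and z lie in one column of the first tableau while x moves them into
   one row of the second, then (y z) x = x (x(y) x(z)) changes the sign of the
   product. *)
Lemma column_row_clash X c r x y z : x \in Sym X -> y \in X -> z \in X -> y != z ->
  c y = c z -> r (x y) = r (x z) -> col_altsum X c * rho x * row_sum X r = 0.
Proof.
move=> xX yX zX yz cyz rxyz; set w := _ * row_sum X r.
have : w = - w.
  rewrite {1}/w -(@row_sum_mull X r (tperm (x y) (x z))); last first.
    by apply: tperm_stab; rewrite ?(Sym_in _ xX).
  rewrite -tpermJ mulrA -[_ * rho x * _]mulrA -rhoM conjgCV conjgK rhoM mulrA.
  rewrite col_altsum_mulr ?tperm_stab // odd_tperm yz expr1.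
  by rewrite scaleN1r !mulNr.
by move/eqP; rewrite -subr_eq0 opprK -mulr2n -scaler_nat scaler_eq0 pnatr_eq0 => /eqP.
Qed.

Lemma card_row_perm X r x m : x \in Sym X ->
  #|[set y in X | r (x y) < m]|%N = #|[set y in X | r y < m]|%N.
Proof.
move=> xX; rewrite -[RHS](card_imset _ (@perm_inj _ x^-1)); apply: eq_card => y.
rewrite inE; apply/andP/imsetP => [[yX rm]|[z]].
  by exists (x y); rewrite ?permK // inE (Sym_in _ xX) yX.
rewrite inE => /andP[zX rm] ->; rewrite permKV; split=> //.
by rewrite -(Sym_in _ xX) permKV.
Qed.

(** A boolean, so that its failure provides the clashing pair of points. It is used with [r \o x],
    the rows after moving the points by x. *)
Definition inj_col X (r c : T -> nat) :=
  [forall y in X, forall z in X, ((r y == r z) && (c y == c z)) ==> (y == z)].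

Lemma inj_colP X r c :
  reflect {in X &, injective (fun y => (r y, c y))} (inj_col X r c).
Proof.
apply: (iffP forall_inP) => [inj y z yX zX [ry cy]|inj y yX].
  by have /forall_inP/(_ z zX) := inj y yX; rewrite ry cy !eqxx => /eqP.
apply/forall_inP => z zX; apply/implyP => /andP[/eqP ry /eqP cy].
by apply/eqP; apply: inj => //; rewrite ry cy.
Qed.

Lemma col_row_eq0 X c r x : x \in Sym X -> ~~ inj_col X (r \o x) c ->
  col_altsum X c * rho x * row_sum X r = 0.
Proof.
move=> xX /forall_inPn[y yX /forall_inPn[z zX]].
by rewrite negb_imply => /andP[/andP[/eqP e /eqP cy] yz]; apply: column_row_clash e.
Qed.

(** Unless every product vanishes by a clash, some x sends the points of each column to distinct
    rows of [r']; counting column by column then gives the dominance inequality, and x does not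
    affect the counts. *)
Lemma col_row_dominance X la r c r' : is_partition la -> tableau X la r c ->
  (forall x, x \in Sym X -> col_altsum X c * rho x * row_sum X r' = 0) \/
  (forall m, #|[set y in X | r' y < m]| <= #|[set y in X | r y < m]|)%N.
Proof.
move=> pla tab; case: (boolP [exists x in Sym X, inj_col X (r' \o x) c]).
  case/exists_inP => x xX /inj_colP inj; right=> m; rewrite -(card_row_perm r' m xX).
  exact: (row_card_le (tableau_down pla tab) inj).
by move/exists_inPn => no; left=> x xX; apply: col_row_eq0 (no x xX).
Qed.

(** Dominance in both directions would make the shapes equal. *)
Lemma col_row_orthogonal X la la' r c r' c' : is_partition la -> is_partition la' ->
    tableau X la r c -> tableau X la' r' c' -> la != la' ->
  (forall x, x \in Sym X -> col_altsum X c * rho x * row_sum X r' = 0) \/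
  (forall x, x \in Sym X -> col_altsum X c' * rho x * row_sum X r = 0).
Proof.
move=> pla pla' tab tab' /eqP ne.
have [|le1] := col_row_dominance r' pla tab; first by left.
have [|le2] := col_row_dominance r pla' tab'; first by right.
case: ne; apply: (tableau_shape pla pla' tab tab') => m.
by apply/eqP; rewrite eqn_leq le1 le2.
Qed.

(** * Absorption by the Young symmetrizer and the resulting central element *)

Section Sandwich.

Variables (X : {set T}) (la : seq nat) (r c : T -> nat).
Hypotheses (pla : is_partition la) (tab : tableau X la r c).

Local Notation a := (row_sum X r).
Local Notation b := (col_altsum X c).
Local Notation e := (b * a).

(** Either x produces a clash and the product is 0, or x = q p with q in the column group and p in
    the row group; then [b] absorbs q up to sign and [a] absorbs p. *)
Lemma sandwich_rho x : x \in Sym X -> exists t, b * rho x * a = t *: e.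
Proof.
move=> xX; case: (boolP (inj_col X (r \o x) c)) => [/inj_colP inj|no]; last first.
  by exists 0; rewrite scale0r; apply: col_row_eq0.
have [|q qS rq] := col_match (tableau_down pla tab) inj.
  by move=> m; apply: card_row_perm.
have [qX _] := stabP _ _ _ qS.
have pS : (q^-1 * x)%g \in stab X r.
  apply/stabP; split=> [|y]; first by rewrite groupM ?groupV.
  case: (boolP (y \in X)) => [yX|yX].
    have y'X : (q^-1)%g y \in X by rewrite (Sym_in _ _) ?groupV.
    by rewrite permM -[LHS]/((r \o x) _) -rq // permKV.
  by rewrite (Sym_out _ yX) // groupM ?groupV.
exists ((-1) ^+ odd_perm q).
by rewrite -[x](mulKVg q) rhoM -mulrA -mulrA row_sum_mull // mulrA col_altsum_mulr // mulZl.
Qed.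

Lemma sandwich M : supported (Sym X) M -> exists t, b * M * a = t *: e.
Proof.
move=> ->; rewrite [b * _]mulr_sumr [X in exists t, X = _]mulr_suml.
apply: (big_ind (fun N => exists t, N = t *: e)) => [|N1 N2 [t1 ->] [t2 ->]|x xX].
- by exists 0; rewrite scale0r.
- by exists (t1 + t2); rewrite scalerDl.
have [t et] := sandwich_rho xX; exists (group_coef M x * t).
by rewrite mulZr mulZl et scalerA.
Qed.

(* In terms of the dimension f of the Specht module this is |X|!/f, the product
   of the hook lengths. *)
Definition tab_scalar := tau (e * e).

Lemma supported_young : supported (Sym X) e.
Proof. by apply: (supportedM (H := Sym_group X)); [apply: supported_col_altsum | apply: supported_row_sum]. Qed.

Lemma young_sqr : e * e = tab_scalar *: e.
Proof.
have [t et] : exists t, b * (a * b) * a = t *: e.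
  by apply: sandwich; apply: (supportedM (H := Sym_group X)); [apply: supported_row_sum | apply: supported_col_altsum].
have eet : e * e = t *: e by rewrite -et !mulrA.
(* The unknown scalar is read off with [tau], which takes the value 1 on [e]. *)
by rewrite /tab_scalar eet linearZ /= (tau_young tab) mulr1.
Qed.

Lemma young_sandwich M : supported (Sym X) M -> e * M * e = (tab_scalar * tau (e * M)) *: e.
Proof.
move=> sM; have [t et] : exists t, b * (a * M * b) * a = t *: e.
  apply: sandwich; apply: (supportedM (H := Sym_group X)); last exact: supported_col_altsum.
  by apply: (supportedM (H := Sym_group X)) => //; apply: supported_row_sum.
have eet : e * M * e = t *: e by rewrite -et !mulrA.
(* Apply [tau]: by cyclicity the trace of [e * M * e] is that of [e * e * M]. *)
rewrite eet; congr (_ *: _); rewrite -[t]mulr1 -(tau_young tab) -linearZ /= -eet.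
by rewrite tauC mulrA young_sqr mulZl linearZ.
Qed.

Lemma stab_card_neq0 h : #|stab X h|%:R != 0 :> C.
Proof. by rewrite pnatr_eq0 -lt0n cardG_gt0. Qed.

(** The element y = a b a is self-adjoint and the trace of its square is the scalar times the
    squared order of the row group. It is nonzero because its own trace is that order. *)
Lemma tab_scalar_gt0 : 0 < tab_scalar.
Proof.
pose y := a * b * a; have sy : star y = y by rewrite /y !starM star_row_sum star_col_altsum mulrA.
have aa : a * a = #|stab X r|%:R *: a by apply: row_sum_nest.
have tyy : tau (y * star y) = #|stab X r|%:R ^+ 2 * tab_scalar.
  have -> : y * star y = #|stab X r|%:R *: (a * (b * a * b * a)).
    by rewrite sy /y -!mulrA [a * (a * _)]mulrA aa mulZl !mulZr.
  rewrite linearZ /= tauC -!mulrA aa !mulZr linearZ /= mulrA.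
  by rewrite /tab_scalar !mulrA.
rewrite lt_def; apply/andP; split; last first.
  have := tau_star_ge0 y; rewrite tyy pmulr_rge0 //.
  by rewrite exprn_gt0 // ltr0n cardG_gt0.
apply/eqP => k0; have y0 : y = 0 by apply: tau_star_eq0; rewrite tyy k0 mulr0.
have : tau y = #|stab X r|%:R.
  by rewrite /y tauC mulrA aa mulZl linearZ /= tauC (tau_young tab) mulr1.
by rewrite y0 linear0 => /esym/eqP; rewrite (negPf (stab_card_neq0 r)).
Qed.

(** With this scaling it becomes the character sum of the Specht module, see [specht_sum]; dividing
    once more by [tab_scalar] gives a central idempotent. *)
Definition tab_elt : GA := tab_scalar^-1 *: conj_sum (Sym_group X) e.

Lemma tab_scalar_neq0 : tab_scalar != 0. Proof. by rewrite gt_eqF ?tab_scalar_gt0. Qed.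

Lemma tab_eltE : tab_elt = tab_scalar^-1 *: conj_sum (Sym_group X) (a * b).
Proof. by rewrite /tab_elt conj_sum_mulC //; apply: supported_col_altsum. Qed.

Lemma supported_tab_elt : supported (Sym X) tab_elt.
Proof. by apply: supportedZ; apply: (supported_conj_sum (H := Sym_group X)); apply: supported_young. Qed.

Lemma central_tab_elt : central (Sym_group X) tab_elt.
Proof. by apply: centralZ; apply: conj_sum_central. Qed.

Lemma tab_scalar_real : tab_scalar^* = tab_scalar.
Proof. by apply: CrealP; rewrite realE ltW ?tab_scalar_gt0. Qed.

Lemma star_tab_elt : star tab_elt = tab_elt.
Proof.
rewrite /tab_elt starZ star_conj_sum starM star_row_sum star_col_altsum conj_sum_mulC; last exact: supported_row_sum.
by congr (_ *: _); rewrite fmorphV /= tab_scalar_real.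
Qed.

(** By the sandwich identity, [e] times its conjugate by x is a multiple of [e * rho x], with the
    coefficient of [e] at x as a factor; summing over x rebuilds [e * e]. *)
Lemma young_tab_elt : e * tab_elt = tab_scalar *: e.
Proof.
have sE := supported_young; rewrite /tab_elt mulZr /conj_sum mulr_sumr.
rewrite (eq_bigr (fun x => (tab_scalar *: e) * (group_coef e x *: rho x))) => [|x xX].
  rewrite -mulr_sumr -[X in _ * X]sE mulZl young_sqr !scalerA.
  by rewrite mulVf ?mul1r // tab_scalar_neq0.
rewrite /conjr [e * _]mulrA [e * (_ * _)]mulrA young_sandwich; last by apply: supported_rho; rewrite groupV.
by rewrite !mulZl !mulZr scalerA.
Qed.

Lemma tab_elt_sqr : tab_elt * tab_elt = tab_scalar *: tab_elt.
Proof.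
rewrite {1}/tab_elt mulZl mul_conj_sum_central; last exact: central_tab_elt.
by rewrite young_tab_elt linearZ /= /tab_elt !scalerA mulrC.
Qed.

Lemma tau_tab_elt : tau tab_elt = #|X|`!%:R / tab_scalar.
Proof. by rewrite /tab_elt linearZ /= tau_conj_sum (tau_young tab) mulr1 card_Sym mulrC. Qed.

(** A form of Schur's lemma: since D commutes with [e], the sandwich identity turns [e * D] into a
    multiple of [e], and summing conjugates carries this over to [tab_elt]. *)
Lemma tab_elt_Schur D : central (Sym_group X) D -> supported (Sym X) D ->
  D * tab_elt = tau (e * D) *: tab_elt.
Proof.
move=> cD sD; set t := tau _; have eD : e * D = t *: e.
  have := young_sandwich sD; rewrite -mulrA (centralC cD supported_young) mulrA young_sqr mulZl -/t => /eqP.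
  by rewrite -scalerA (inj_eq (scalerI tab_scalar_neq0)) => /eqP.
rewrite (centralC cD supported_tab_elt) /tab_elt mulZl mul_conj_sum_central //.
by rewrite eD linearZ /= !scalerA mulrC.
Qed.

End Sandwich.

(** The vanishing of one of the two families of column-row products is enough, because the two
    elements commute. *)
Lemma tab_elt_orthogonal X la la' r c r' c' : is_partition la -> is_partition la' ->
    tableau X la r c -> tableau X la' r' c' -> la != la' ->
  tab_elt X r c * tab_elt X r' c' = 0.
Proof.
have half r1 c1 r2 c2 : (forall x, x \in Sym X -> col_altsum X c1 * rho x * row_sum X r2 = 0) ->
    tab_elt X r1 c1 * tab_elt X r2 c2 = 0.
  move=> h0; rewrite [X in X * _]tab_eltE mulZl mul_conj_sum_central; last exact: central_tab_elt.
  rewrite -mulrA (_ : col_altsum X c1 * _ = 0) ?mulr0 ?linear0 ?scaler0 //.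
  rewrite tab_eltE mulZr /conj_sum mulr_sumr big1 ?scaler0 // => x xX.
  by rewrite /conjr !mulrA h0 ?groupV // !mul0r.
move=> pla pla' tab tab' ne; have [h0|h0] := col_row_orthogonal pla pla' tab tab' ne.
  exact: half.
rewrite (centralC (@central_tab_elt X r c) (@supported_tab_elt X r' c')).
exact: half.
Qed.

Lemma tab_elt_transport X Y r c (s : {perm T}) :
  (forall y, (s y \in Y) = (y \in X)) ->
  conjr s (tab_elt X (r \o s) (c \o s)) = tab_elt Y r c /\ 
  tab_scalar X (r \o s) (c \o s) = tab_scalar Y r c.
Proof.
move=> sXY; have ke : tab_scalar X (r \o s) (c \o s) = tab_scalar Y r c.
  by rewrite /tab_scalar -(tau_conjr s) !conjrM !(row_sum_transport sXY) !(col_altsum_transport sXY).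
split=> //; rewrite /tab_elt ke linearZ /= (conj_sum_transport sXY).
by rewrite conjrM (row_sum_transport sXY) (col_altsum_transport sXY).
Qed.

(** Two tableaux of one shape on X differ by a permutation of X, and the element is central. *)
Lemma tab_elt_unique X la r c r' c' : tableau X la r c -> tableau X la r' c' ->
  tab_elt X r c = tab_elt X r' c' /\ tab_scalar X r c = tab_scalar X r' c'.
Proof.
move=> tab tab'; have [s sX es] := tableau_conj tab tab'.
have [e1 e2] := tab_elt_transport r c (fun y => Sym_in y sX).
have er : row_sum X (r \o s) = row_sum X r' by apply: eq_row_sum => y /es[].
have ec : col_altsum X (c \o s) = col_altsum X c' by apply: eq_col_altsum => y /es[].
have k' : tab_scalar X (r \o s) (c \o s) = tab_scalar X r' c' by rewrite /tab_scalar er ec.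
split; last by rewrite -e2.
rewrite -e1 -[RHS](_ : tab_elt X (r \o s) (c \o s) = _); last by rewrite /tab_elt er ec k'.
exact: central_tab_elt.
Qed.

End YoungElements.

(** * Specht characters *)

(** L is a projection onto U, so the trace of g on U is the trace on the whole space of L followed
    by g. *)
Lemma mxtrace_submod (F : fieldType) (gT : finGroupType) (H : {group gT}) n
    (rH : mx_representation F H n) (U : 'M_n) (modU : mxmodule rH U) (L : 'M_n) g :
  (L <= U)%MS -> U *m L = U -> g \in H -> \tr (submod_repr modU g) = \tr (L *m rH g).
Proof.
move=> LU UL gH; pose D := in_submod U L; pose B := row_base U.
have LE : L = D *m B by rewrite -[L](in_submodK LU).
have BL : B *m L = B.
  have /submxP[E BE] : (B <= U)%MS by rewrite eq_row_base.
  by rewrite BE -mulmxA UL.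
have BD : B *m D = 1%:M.
  by apply: (row_free_inj (row_base_free U)); rewrite mul1mx -mulmxA -LE BL.
rewrite {1}LE -mulmxA.
have -> : B *m rH g = submod_repr modU g *m B.
  have := val_submodJ modU (1%:M : 'M_(\rank U)) gH.
  by rewrite /val_submod /= !mul1mx.
by rewrite mulmxA [RHS]mxtrace_mulC mulmxA BD mul1mx.
Qed.

Section SpechtCharacter.

Variables (C : numClosedFieldType) (T : finType).
Local Notation GA := 'M[C]_#|[set: {perm T}]%G|.
Local Notation rho := (@rho C {perm T}).
Implicit Types (X : {set T}) (M N : GA).

Section Subregular.

Variable H : {group {perm T}}.
Local Notation RH := (regular_repr C H).

(* Carries an element supported on [H] to the regular representation of [H],
   where the Specht module is defined. *)
Definition subreg M : 'M[C]_#|H| := \sum_(s in H) group_coef M s *: RH s.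

Lemma subreg_is_linear : linear subreg.
Proof.
move=> a M N; rewrite /subreg scaler_sumr -big_split; apply: eq_bigr => s _.
by rewrite group_coefD group_coefZ scalerDl scalerA.
Qed.
HB.instance Definition _ :=
  GRing.isLinear.Build C GA 'M[C]_#|H| *:%R subreg subreg_is_linear.

Lemma subreg_rho s : s \in H -> subreg (rho s) = RH s.
Proof.
move=> sH; rewrite /subreg (bigD1 s) //= big1 => [|t /andP[_ ts]].
  by rewrite addr0 /group_coef -rhoM tau_rho mulgV eqxx scale1r.
by rewrite /group_coef -rhoM tau_rho -eq_mulgV1 eq_sym (negPf ts) scale0r.
Qed.

Lemma subregM M N : supported H M -> supported H N -> subreg (M * N) = subreg M *m subreg N.
Proof.
move=> -> ->; rewrite mulr_suml ![subreg (\sum_(i in _) _)]linear_sum mulmx_suml.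
apply: eq_bigr => s sH.
rewrite mulr_sumr [LHS]linear_sum mulmx_sumr.
apply: eq_bigr => t tH.
rewrite mulZl mulZr -rhoM !linearZ /= subreg_rho ?groupM // repr_mxM // !subreg_rho //.
by rewrite -scalemxAl scalerA mulrC -scalerA.
Qed.

Lemma gring_row_subreg M s : s \in H ->
  gring_row (subreg M) 0 (gring_index H s) = group_coef M s.
Proof.
move=> sH; have rowE t : t \in H ->
    gring_row (RH t) 0 (gring_index H s) = (t == s)%:R.
  move=> tH; rewrite /gring_row /= rowK gring_indexK // mul1g mxE eqxx /=.
  by rewrite (can_in_eq (gring_indexK (G := H))) // eq_sym.
rewrite /subreg linear_sum summxE (bigD1 s) //= big1 => [|t /andP[tH ts]].
  by rewrite linearZ mxE rowE // eqxx mulr1 addr0.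
by rewrite linearZ mxE rowE // (negPf ts) mulr0.
Qed.

End Subregular.

(** Entrywise conjugation without transposition: on the group ring it conjugates coefficients and
    fixes group elements. It serves to show that the coefficients of [tab_elt] are real. *)
Definition conj_coefs M : GA := map_mx Num.conj M.

Lemma conj_coefs_rho s : conj_coefs (rho s) = rho s.
Proof. by apply/matrixP => i j; rewrite mxE rhoE conjC_nat. Qed.

Lemma tau_conj_coefs M : tau (conj_coefs M) = (tau M)^*.
Proof.
by rewrite /tau /conj_coefs rmorphM fmorphV /= conjC_nat -trace_map_mx.
Qed.

Lemma tau_star M : tau (star M) = (tau M)^*.
Proof. by rewrite -tau_conj_coefs /conj_coefs /star /tau -map_trmx mxtrace_tr. Qed.

Lemma conj_coefsM M N : conj_coefs (M * N) = conj_coefs M * conj_coefs N.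
Proof. exact: map_mxM. Qed.

Lemma conj_coefsZ a M : conj_coefs (a *: M) = a^* *: conj_coefs M.
Proof. exact: map_mxZ. Qed.

Lemma conj_coefs_sum I (r : seq I) (P : pred I) (F : I -> GA) :
  conj_coefs (\sum_(i <- r | P i) F i) = \sum_(i <- r | P i) conj_coefs (F i).
Proof. exact: raddf_sum. Qed.

Section Character.

Variables (X : {set T}) (la : seq nat).
Hypotheses (pla : is_partition la) (cardX : sumn la = #|X|).

Local Notation r := (tableau_row la X).
Local Notation c := (tableau_col la X).
Local Notation kap := (tab_scalar C X r c).
Local Notation a := (row_sum C X r).
Local Notation b := (col_altsum C X c).
Local Notation RH := (regular_repr C (Sym_group X)).

Let tab := canonical_tableau cardX.

Lemma conj_coefs_tab_elt : conj_coefs (tab_elt C X r c) = tab_elt C X r c.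
Proof.
have cj_a : conj_coefs a = a by rewrite /row_sum conj_coefs_sum; apply: eq_bigr => p _; rewrite conj_coefs_rho.
have cj_b : conj_coefs b = b.
  rewrite /col_altsum conj_coefs_sum; apply: eq_bigr => p _.
  by rewrite conj_coefsZ conj_coefs_rho rmorphXn rmorphN rmorph1.
rewrite /tab_elt conj_coefsZ fmorphV /= (tab_scalar_real C tab); congr (_ *: _).
rewrite /conj_sum conj_coefs_sum; apply: eq_bigr => x _.
by rewrite /conjr !conj_coefsM !conj_coefs_rho cj_a cj_b.
Qed.

(** Self-adjointness relates the coefficients at s and its inverse by conjugation, and the
    coefficients are real. *)
Lemma group_coef_tab_eltV s : group_coef (tab_elt C X r c) s^-1 = group_coef (tab_elt C X r c) s.
Proof.
rewrite /group_coef invgK; transitivity (tau (tab_elt C X r c * rho s))^*.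
  by rewrite -tau_conj_coefs conj_coefsM conj_coefs_tab_elt conj_coefs_rho.
by rewrite -tau_star starM star_rho (star_tab_elt C tab) tauC.
Qed.

Lemma young_symmetrizerE : young_symmetrizer C la X = subreg (Sym_group X) (a * b).
Proof.
rewrite /young_symmetrizer [X in subreg _ (X * _)]/row_sum mulr_suml linear_sum.
apply: eq_bigr => p pS; rewrite /col_altsum mulr_sumr linear_sum.
apply: eq_bigr => q qS; rewrite mulZr linearZ /= -rhoM subreg_rho //.
by rewrite groupM ?(stab_Sym pS) ?(stab_Sym qS).
Qed.

Lemma young_sqr_rev : (a * b) * (a * b) = kap *: (a * b).
Proof.
have kk := tab_scalar_real C tab; have := young_sqr C pla tab => /(congr1 (@star _ _)).
by rewrite starZ !starM star_row_sum star_col_altsum kk.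
Qed.

(** The symmetrizer divided by its scalar is idempotent, so left multiplication by it projects the
    group ring of [Sym X] onto the Specht module and commutes with the right action. The character
    is the trace of this projection followed by s. *)
Lemma specht_charE s : s \in Sym X -> specht_char C la X s = group_coef (tab_elt C X r c) s.
Proof.
move=> sX; pose y := gring_row (young_symmetrizer C la X).
have sab : supported (Sym_group X) (a * b) by apply: supportedM; [apply: supported_row_sum | apply: supported_col_altsum].
have k0 : kap != 0 := tab_scalar_neq0 C tab.
(* Row i is the image of the i-th group element x, namely the scaled symmetrizer times x. *)
pose L : 'M_#|Sym_group X| :=
  kap^-1 *: \matrix_i (y *m RH (enum_val (A := [eta mem (Sym X)]) i)).
have yE g : g \in Sym_group X -> y *m RH g = gring_row (subreg (Sym_group X) (a * b * rho g)).
  move=> gX; rewrite /y young_symmetrizerE -gring_row_mul -(subreg_rho gX).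
  by rewrite -(subregM sab (supported_rho C gX)).
have vL M : gring_row (subreg (Sym_group X) M) *m L =
    kap^-1 *: (y *m subreg (Sym_group X) M).
  rewrite /L -scalemxAr; congr (_ *: _); rewrite mulmx_sum_row /subreg mulmx_sumr.
  rewrite [RHS]big_enum_val; apply: eq_bigr => i _.
  rewrite rowK -scalemxAr -(gring_row_subreg M (enum_valP i)) gring_valK.
  by [].
have yL g : g \in Sym_group X -> y *m RH g *m L = y *m RH g.
  move=> gX; rewrite {1}yE // vL (subregM sab (supported_rho C gX)) mulmxA.
  rewrite [y *m _](_ : _ = kap *: y).
    by rewrite -scalemxAl scalerA mulVf // scale1r subreg_rho.
  rewrite /y young_symmetrizerE -gring_row_mul -(subregM sab sab) young_sqr_rev.
  by rewrite !linearZ.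
rewrite /specht_char /specht_repr (@mxtrace_submod _ _ _ _ _ _ _ L) //.
(* The diagonal entry at x is the coefficient of x in the symmetrizer times x s, that is, the trace
   of a conjugate of the symmetrizer times s. The sum over x is the coefficient of [tab_elt] at the
   inverse of s. *)
- rewrite /L -scalemxAl linearZ /= /mxtrace -group_coef_tab_eltV /group_coef invgK tab_eltE mulZl linearZ /=.
  congr (_ * _); rewrite /conj_sum mulr_suml linear_sum [RHS]big_enum_val.
  apply: eq_bigr => i _; set x := enum_val i; have xX : x \in Sym X := enum_valP i.
  set K := (X in X *m _); transitivity (row i (K *m RH s) 0 i).
    by rewrite [RHS]mxE.
  rewrite row_mul /K rowK -mulmxA -repr_mxM // yE ?groupM //.
  rewrite -{2}(gring_valK i) gring_row_subreg // /group_coef rhoM /conjr.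
  by rewrite [LHS]tauC !mulrA.
- apply/row_subP => i; rewrite /L linearZ /= rowK scalemx_sub //.
  by apply: mxmodule_trans; rewrite ?cyclic_mx_module ?cyclic_mx_id ?enum_valP.
apply/row_matrixP => i; rewrite row_mul.
have /cyclic_mxP[A /envelop_mxP[f ->] ->] : (row i (specht_mx C la X) <= specht_mx C la X)%MS.
  exact: row_sub.
rewrite mulmx_sumr mulmx_suml; apply: eq_bigr => g gX.
by rewrite -[y *m (_ *: _)]scalemxAr -scalemxAl yL.
Qed.

Lemma specht_sum : \sum_(s in Sym X) specht_char C la X s *: rho s = tab_elt C X r c.
Proof.
rewrite [RHS](supported_tab_elt C X r c); apply: eq_bigr => s sX.
by rewrite specht_charE.
Qed.

(** Evaluate the character at the identity. *)
Lemma specht_rank : (\rank (specht_mx C la X))%:R = #|X|`!%:R / kap.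
Proof.
rewrite -(tau_tab_elt C tab); transitivity (group_coef (tab_elt C X r c) 1%g); last first.
  by rewrite /group_coef invg1 rho1 mulr1.
rewrite -specht_charE ?group1 // /specht_char repr_mx1 mxtrace1.
by [].
Qed.


End Character.

End SpechtCharacter.

(** * Branching rule *)

Section Idempotents.

Variables (C : numClosedFieldType) (gT : finGroupType).
Local Notation GA := 'M[C]_#|[set: gT]%G|.
Local Notation rho := (@rho C gT).
Implicit Types (M N : GA) (H : {group gT}).

(* The sum is the trace of the idempotent operator M |-> e1 M e2 of the group
   algebra of H. *)
Lemma idempotent_intertwiners H (e1 e2 : GA) : supported H e1 -> supported H e2 ->
    e1 * e1 = e1 -> e2 * e2 = e2 ->
  exists m : nat, \sum_(y in H) tau (e1 * conjr y e2) = m%:R /\ (e1 * e2 != 0 -> (0 < m)%N).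
Proof.
move=> s1 s2 e11 e22; pose ev (i : 'I_#|H|) : gT := enum_val (A := [eta mem H]) i.
have evH i : ev i \in H by apply: (enum_valP (A := [eta mem H])).
pose Q : 'M[C]_#|H| := \matrix_(i, j) group_coef (e1 * rho (ev i) * e2) (ev j).
have sQ y : y \in H -> supported H (e1 * rho y * e2).
  by move=> yH; apply: supportedM => //; apply: supportedM => //; apply: supported_rho.
have QQ : Q *m Q = Q.
  apply/matrixP=> i j; rewrite !mxE.
  rewrite -[in RHS]e11 -[in RHS]e22.
  have -> : e1 * e1 * rho (ev i) * (e2 * e2) = e1 * (e1 * rho (ev i) * e2) * e2.
    by rewrite !mulrA.
  rewrite [X in e1 * X * e2](sQ _ (evH i)) mulr_sumr mulr_suml group_coef_bigsum.
  rewrite [RHS](big_enum_val (A := [eta mem H])); apply: eq_bigr => k _.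
  by rewrite !mxE mulZr mulZl group_coefZ.
exists (\rank Q); split.
  rewrite -(mxtrace_idempotent QQ) /mxtrace (reindex_inj invg_inj) /=.
  rewrite (eq_bigl (mem H)) => [|y]; last by rewrite /= groupV.
  rewrite (big_enum_val (A := [eta mem H])); apply: eq_bigr => i _.
  by rewrite mxE /group_coef /conjr invgK !mulrA.
move=> ne; rewrite lt0n mxrank_eq0; apply: contra ne => /eqP Q0.
apply/eqP/(supported_eq (H := H)); [exact: supportedM | exact: supported0 |] => g gH.
have evK x : x \in H -> ev (enum_rank_in (group1 H) x) = x.
  by move=> xH; apply: enum_rankK_in.
(* The row of [Q] indexed by the identity lists the coefficients of [e1 * e2]. *)
have := congr1 (fun A : 'M_#|H| => A (enum_rank_in (group1 H) 1%g) (enum_rank_in (group1 H) g)) Q0.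
rewrite !mxE !evK ?group1 // rho1 mulr1 => ->.
by rewrite /group_coef mul0r linear0.
Qed.

End Idempotents.

Section Branching.

Variables (C : numClosedFieldType) (T : finType).
Local Notation GA := 'M[C]_#|[set: {perm T}]%G|.
Local Notation rho := (@rho C {perm T}).
Implicit Types (X Y : {set T}) (M N : GA) (la mu nu : seq nat).

(* By [specht_sum] this is the sum of chi^la(s) s over [Sym X]. *)
Definition specht_elt la X : GA := tab_elt C X (tableau_row la X) (tableau_col la X).
Definition specht_scalar la X : C := tab_scalar C X (tableau_row la X) (tableau_col la X).

Section Basics.

Variables (k : nat) (la : seq nat) (X : {set T}).
Hypotheses (lak : la \in partitions k) (Xk : #|X| = k).

Lemma partitions_partition : is_partition la.
Proof. by move: lak; rewrite mem_partitions => /andP[]. Qed.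

Lemma partitions_sumn : sumn la = k.
Proof. by move: lak; rewrite mem_partitions => /andP[_ /eqP]. Qed.

Lemma specht_tableau : tableau X la (tableau_row la X) (tableau_col la X).
Proof. by apply: canonical_tableau; rewrite partitions_sumn. Qed.

Lemma supported_specht_elt : supported (Sym X) (specht_elt la X). Proof. exact: supported_tab_elt. Qed.
Lemma central_specht_elt : central (Sym_group X) (specht_elt la X). Proof. exact: central_tab_elt. Qed.
Lemma star_specht_elt : star (specht_elt la X) = specht_elt la X. Proof. exact: star_tab_elt specht_tableau. Qed.
Lemma specht_elt_sqr : specht_elt la X * specht_elt la X = specht_scalar la X *: specht_elt la X.
Proof. exact: tab_elt_sqr partitions_partition specht_tableau. Qed.
Lemma specht_scalar_gt0 : 0 < specht_scalar la X. Proof. exact: tab_scalar_gt0 specht_tableau. Qed.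
Lemma specht_scalar_neq0 : specht_scalar la X != 0. Proof. exact: tab_scalar_neq0 specht_tableau. Qed.
Lemma tau_specht_elt : tau (specht_elt la X) = k`!%:R / specht_scalar la X.
Proof. by rewrite (tau_tab_elt C specht_tableau) Xk. Qed.
Lemma tau_specht_elt_sqr : tau (specht_elt la X * specht_elt la X) = k`!%:R.
Proof. by rewrite specht_elt_sqr linearZ /= tau_specht_elt mulrC divfK ?specht_scalar_neq0. Qed.

Lemma specht_elt_orthogonal mu : mu \in partitions k -> mu != la -> specht_elt mu X * specht_elt la X = 0.
Proof.
rewrite mem_partitions => /andP[pmu /eqP smu] ne.
apply: (tab_elt_orthogonal C pmu partitions_partition _ specht_tableau) => //.
by apply: canonical_tableau; rewrite smu.
Qed.

(** s need not match the canonical tableaux of X and Y, as these follow the enumerations;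
    independence of the tableau makes up for it. *)
Lemma specht_elt_transport Y (s : {perm T}) : (forall y, (s y \in Y) = (y \in X)) ->
  conjr s (specht_elt la X) = specht_elt la Y /\ specht_scalar la X = specht_scalar la Y.
Proof.
move=> sXY; have Yk : #|Y| = k.
  rewrite -Xk -(card_imset (mem X) (@perm_inj _ s)); apply: eq_card => y.
  rewrite -{1}(permKV s y) sXY; apply/idP/imsetP => [yX|[z zX ->]]; last by rewrite permK.
  by exists ((s^-1)%g y); rewrite ?permKV.
have tabY : tableau Y la (tableau_row la Y) (tableau_col la Y).
  by apply: canonical_tableau; rewrite partitions_sumn.
have [e1 k1] := tab_elt_transport C (tableau_row la Y) (tableau_col la Y) sXY.
have [e2 k2] := tab_elt_unique C (tableau_transport sXY tabY) specht_tableau.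
by rewrite /specht_elt /specht_scalar -e2 -k2 e1 k1.
Qed.

End Basics.

(** The character sum of the induced representation: the induced character at s adds the characters
    of s on X minus i over the fixed points i of s in X. *)
Definition ind_elt la X := \sum_(i in X) specht_elt la (X :\ i).

Section BoxAdded.

Variables (k : nat) (la mu : seq nat) (X : {set T}) (x : T).
Hypotheses (lak : la \in partitions k) (Xk : #|X| = k.+1) (xX : x \in X).

Lemma card_setD1 : #|X :\ x| = k.
Proof. by apply: succn_inj; rewrite -Xk [in RHS](cardsD1 x) xX. Qed.

Hypothesis muA : mu \in add_box la.

Lemma add_box_partitions : mu \in partitions k.+1.
Proof.
have [pmu smu] := add_box_partition muA.
by rewrite mem_partitions /partition_of pmu smu (partitions_sumn lak) /=.
Qed.

(** The point x is put into the added box, at the end of its row. *)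
Lemma extend_tableau r c : tableau (X :\ x) la r c ->
  exists r' c', [/\ tableau X mu r' c', {in X :\ x, r =1 r'} & {in X :\ x, c =1 c'}].
Proof.
have pla := partitions_partition lak.
case/add_boxP: muA => i il [mue pmu] [inj cl ex].
exists (fun y => if y == x then i else r y), (fun y => if y == x then nth 0%N la i else c y).
have neq y : y \in X -> y != x -> y \in X :\ x by rewrite !inE => -> ->.
split; last 2 first.
- by move=> y; rewrite !inE => /andP[/negPf->].
- by move=> y; rewrite !inE => /andP[/negPf->].
split.
- move=> y z yX zX; case: (eqVneq y x) (eqVneq z x) => [->|yx] [->|zx] //.
  + by case=> e1 e2; have := cl z (neq z zX zx); rewrite -e1 -e2 ltnn.
  + by case=> e1 e2; have := cl y (neq y yX yx); rewrite e1 e2 ltnn.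
  by apply: inj; apply: neq.
- move=> y yX; rewrite mue nth_incr_nth; case: eqVneq => [_|yx]; first by rewrite eqxx.
  by apply: leq_trans (cl y (neq y yX yx)) _; apply: leq_addl.
move=> i' j; rewrite mue nth_incr_nth; case: (eqVneq i i') => [<-|ii']; last first.
  by case/ex => y; rewrite !inE => /andP[/negPf yx yX] [ry cy]; exists y; rewrite // yx.
rewrite add1n ltnS leq_eqVlt => /orP[/eqP->|].
  by exists x; rewrite // eqxx.
by case/ex => y; rewrite !inE => /andP[/negPf yx yX] [ry cy]; exists y; rewrite // yx.
Qed.

Lemma Sym_D1 : Sym (X :\ x) \subset Sym X.
Proof.
apply/subsetP=> s; rewrite !inE => sx; apply: subset_trans sx _.
exact: subsetDl.
Qed.

Lemma stab_nest h h' : {in X :\ x, h =1 h'} -> stab (X :\ x) h \subset stab X h'.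
Proof.
move=> e; rewrite (eq_stab e); apply/subsetP => s /stabP[sX hs].
by apply/stabP; split=> //; apply: (subsetP Sym_D1).
Qed.

(* The pairing is nonzero because the column sums of the two nested tableaux are
   adjacent after a cyclic shift of b a a' b', and so are the row sums. *)
Lemma branching_multiplicity :
  exists m : nat, tau (specht_elt la (X :\ x) * specht_elt mu X) = k`!%:R * m%:R /\ (0 < m)%N.
Proof.
have tab := specht_tableau lak card_setD1; set r := tableau_row _ _ in tab; set c := tableau_col _ _ in tab.
have [r' [c' [tab' er ec]]] := extend_tableau tab.
have [e1 e2] := tab_elt_unique C (specht_tableau add_box_partitions Xk) tab'.
have pla := partitions_partition lak; have pmu := partitions_partition add_box_partitions.
pose ba := col_altsum C (X :\ x) c * row_sum C (X :\ x) r.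
pose ab' := row_sum C X r' * col_altsum C X c'.
pose K := tab_scalar C (X :\ x) r c; pose K' := tab_scalar C X r' c'.
have K0 : K != 0 := tab_scalar_neq0 C tab. have K0' : K' != 0 := tab_scalar_neq0 C tab'.
have sba : supported (Sym_group (X :\ x)) ba by exact: supported_young.
have sba' : supported (Sym_group X) ba := supportedS Sym_D1 sba.
have sab' : supported (Sym_group X) ab' by apply: supportedM; [apply: supported_row_sum | apply: supported_col_altsum].
have baba : ba * ba = K *: ba := young_sqr C pla tab.
have abab : ab' * ab' = K' *: ab'.
  have kk := tab_scalar_real C tab'; have := young_sqr C pmu tab' => /(congr1 (@star _ _)).
  by rewrite starZ !starM star_row_sum star_col_altsum kk.
have [||||m [em m0]] := @idempotent_intertwiners C {perm T} (Sym_group X) (K^-1 *: ba) (K'^-1 *: ab').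
- exact: supportedZ.
- exact: supportedZ.
- by rewrite mulZl mulZr baba !scalerA -mulrA mulVf // mulr1.
- by rewrite mulZl mulZr abab !scalerA -mulrA mulVf // mulr1.
exists m; split; last first.
  apply: m0; apply: contraTneq isT => /(congr1 (fun M => tau (M : GA))).
  rewrite linear0 mulZl mulZr !linearZ /= /ba /ab'.
  rewrite [_ * (row_sum C X r' * _)]mulrA -[_ * row_sum C X r']mulrA.
  rewrite row_sum_nest ?stab_nest // mulZr mulZl linearZ /= tauC [col_altsum C X c' * _]mulrA col_altsum_nest ?stab_nest //.
  rewrite mulZl linearZ /= (tau_young C tab') mulr1 => /eqP.
  rewrite !mulf_eq0 !invr_eq0 (negPf K0) (negPf K0') /=.
  by rewrite !(negPf (stab_card_neq0 _ _ _)).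
rewrite -em /specht_elt e1 -/r -/c {1}/tab_elt mulZl.
rewrite (mul_conj_sum_central _ (N := tab_elt C X r' c')); last first.
  by move=> y yX; apply: central_tab_elt; apply: (subsetP Sym_D1).
rewrite linearZ /= tau_conj_sum card_Sym card_setD1 tab_eltE mulZr linearZ /=.
rewrite -/K -/K' -/ba -/ab' mulrCA; congr (_ * _).
rewrite /conj_sum mulr_sumr linear_sum !mulr_sumr; apply: eq_bigr => y _.
by rewrite [conjr y (_ *: _)]linearZ /= mulZl mulZr !linearZ.
Qed.

End BoxAdded.

End Branching.

Section BranchingRule.

Variables (C : numClosedFieldType) (T : finType).
Local Notation GA := 'M[C]_#|[set: {perm T}]%G|.
Local Notation rho := (@rho C {perm T}).
Local Notation specht_elt := (@specht_elt C T).
Local Notation specht_scalar := (@specht_scalar C T).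
Local Notation ind_elt := (@ind_elt C T).
Implicit Types (X Y : {set T}) (M N : GA) (la mu nu : seq nat).

Lemma sum_specht_elt_mul k X (r : seq (seq nat)) (t : seq nat -> C) mu :
    #|X| = k -> uniq r -> {subset r <= partitions k} -> mu \in partitions k ->
  (\sum_(nu <- r) t nu *: specht_elt nu X) * specht_elt mu X =
    if mu \in r then (t mu * specht_scalar mu X) *: specht_elt mu X else 0.
Proof.
move=> Xk ur rk muk; have off nu : nu \in r -> nu != mu -> (t nu *: specht_elt nu X) * specht_elt mu X = 0.
  by move=> nur ne; rewrite mulZl (specht_elt_orthogonal C muk Xk) ?scaler0 ?rk.
rewrite mulr_suml; case: ifP => mur.
  rewrite (bigD1_seq mu) //= big_seq_cond big1 => [|nu /andP[]]; last exact: off.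
  by rewrite addr0 mulZl (specht_elt_sqr C muk Xk) scalerA.
rewrite big_seq big1 // => nu nur; apply: off => //.
by apply: contraFneq mur => <-.
Qed.

Lemma tau_sum_specht_elt k X (r : seq (seq nat)) : #|X| = k -> uniq r -> {subset r <= partitions k} ->
  tau ((\sum_(nu <- r) specht_elt nu X) * (\sum_(nu <- r) specht_elt nu X)) = k`!%:R * (size r)%:R.
Proof.
move=> Xk ur rk; rewrite mulr_sumr linear_sum /= big_seq.
rewrite (eq_bigr (fun=> k`!%:R)) => [|mu mur].
  by rewrite -big_seq big_const_seq count_predT iter_addr_0 mulr_natr.
rewrite (eq_bigr (fun nu => (fun=> 1) nu *: specht_elt nu X)) => [|nu _]; last by rewrite scale1r.
rewrite (sum_specht_elt_mul _ Xk ur rk (rk _ mur)) mur mul1r.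
by rewrite -(specht_elt_sqr C (rk _ mur) Xk) (tau_specht_elt_sqr C (rk _ mur) Xk).
Qed.

Lemma central_ind_elt la k X : la \in partitions k -> #|X| = k.+1 -> central (Sym_group X) (ind_elt la X).
Proof.
move=> lak Xk s sX; rewrite /ind_elt linear_sum /= [RHS](reindex_inj (@perm_inj _ s)) /=.
apply: eq_big => [i|i iX]; first by rewrite (Sym_in i sX).
apply: (proj1 (specht_elt_transport C lak (card_setD1 Xk iX) _)) => y.
by rewrite !inE (inj_eq perm_inj) (Sym_in y sX).
Qed.

Lemma star_ind_elt la k X : la \in partitions k -> #|X| = k.+1 -> star (ind_elt la X) = ind_elt la X.
Proof.
move=> lak Xk; rewrite star_sum; apply: eq_bigr => i iX.
exact: (star_specht_elt C lak (card_setD1 Xk iX)).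
Qed.

Lemma swap_point X x y z : x \in X -> y \in X ->
  (tperm x y z \in X :\ y) = (z \in X :\ x).
Proof.
move=> xX yX; rewrite !inE -{2}(tpermL x y) (inj_eq perm_inj).
by rewrite (Sym_in _ (tperm_Sym xX yX)).
Qed.

(** The transposition of x and i carries one summand to the other and leaves N unchanged, so all
    summands pair equally with N. *)
Lemma tau_ind_elt k la X x N : la \in partitions k -> #|X| = k.+1 -> x \in X ->
    central (Sym_group X) N ->
  tau (ind_elt la X * N) = k.+1%:R * tau (specht_elt la (X :\ x) * N).
Proof.
move=> lak Xk xX cN; rewrite /ind_elt mulr_suml linear_sum /=.
rewrite (eq_bigr (fun=> tau (specht_elt la (X :\ x) * N))) => [|i iX].
  by rewrite sumr_const Xk mulr_natl.
have [<- _] := specht_elt_transport C lak (card_setD1 Xk xX) (fun z => swap_point z xX iX).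
by rewrite -{1}(cN _ (tperm_Sym xX iX)) -conjrM tau_conjr.
Qed.

Definition induction_rule k := forall X la, #|X| = k.+1 -> la \in partitions k ->
  ind_elt la X = \sum_(mu <- add_box la) specht_elt mu X.

(** Stated on coefficients, since the restriction of a character just forgets the coefficients
    outside the subgroup. *)
Definition restriction_rule k := forall X mu x s, #|X| = k.+1 -> mu \in partitions k.+1 ->
  x \in X -> s \in Sym (X :\ x) ->
  group_coef (specht_elt mu X) s = \sum_(la <- partitions k | mu \in add_box la) group_coef (specht_elt la (X :\ x)) s.

(** The decomposition of 1 into the central idempotents of the Specht modules. *)
Definition completeness k := forall X, #|X| = k ->
  \sum_(la <- partitions k) (specht_scalar la X)^-1 *: specht_elt la X = 1.

Lemma Sym_setI X Y : Sym X :&: Sym Y = Sym (X :&: Y).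
Proof.
apply/setP=> s; rewrite !inE; apply/andP/subsetP => [[/subsetP sX /subsetP sY] y sy|sXY].
  by rewrite inE sX ?sY.
by split; apply/subsetP => y /sXY; rewrite inE => /andP[].
Qed.

(** Only permutations fixing both i and j contribute. On them both factors restrict to the same sum
    over the partitions below [la], whose terms are orthogonal with trace norm k! each. *)
Lemma tau_specht_elt_pair k la X i j : restriction_rule k -> #|X| = k.+2 -> la \in partitions k.+1 ->
    i \in X -> j \in X -> i != j ->
  tau (specht_elt la (X :\ i) * specht_elt la (X :\ j)) = k`!%:R * (size (removable la))%:R.
Proof.
move=> res Xk lak iX jX ij; set Z := X :\ i :\ j.
have Zij : Z = X :\ j :\ i by rewrite /Z !setDDl setUC.
have jXi : j \in X :\ i by rewrite !inE eq_sym ij.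
have iXj : i \in X :\ j by rewrite !inE ij.
have Zk : #|Z| = k by apply: card_setD1 jXi; apply: card_setD1.
rewrite (tauM_supported (supported_specht_elt C la _) (supported_specht_elt C la _)); last by move=> s; rewrite groupV.
rewrite Sym_setI (_ : _ :&: _ = Z); last first.
  by apply/setP => y; rewrite /Z !inE; case: (y == i); case: (y == j); case: (y \in X).
pose r := [seq nu <- partitions k | la \in add_box nu].
rewrite -(size_partitions_removable (k := k)) -?mem_partitions // -/r -(tau_sum_specht_elt (X := Z)) ?filter_uniq ?partitions_uniq //.
  have sW : supported (Sym Z) (\sum_(nu <- r) specht_elt nu Z) by apply: supported_big => nu _; apply: supported_specht_elt.
  rewrite (tauM_supported sW sW); last by move=> s; rewrite groupV.
  rewrite setIid; apply: eq_bigr => s sZ.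
  have ci := card_setD1 Xk iX; have cj := card_setD1 Xk jX.
  rewrite (res (X :\ i) la j s ci lak jXi sZ) (res (X :\ j) la i _ cj lak iXj) -?Zij ?groupV //.
  by rewrite !group_coef_bigsum !big_filter.
by move=> nu; rewrite mem_filter => /andP[].
Qed.

(** Fixing one factor at x, the diagonal term gives k!, and each of the k others gives (k-1)! times
    the number of removable boxes; the total is k! times the number of addable ones. For k = 0 there
    is only the diagonal term. *)
Lemma tau_ind_elt_sqr k la X : (if k is k'.+1 then restriction_rule k' else True) ->
    #|X| = k.+1 -> la \in partitions k ->
  tau (ind_elt la X * ind_elt la X) = k.+1`!%:R * (size (add_box la))%:R.
Proof.
move=> res Xk lak; have [x xX] : exists x, x \in X by apply/card_gt0P; rewrite Xk.
rewrite (tau_ind_elt lak Xk xX); last exact: (central_ind_elt lak Xk).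
rewrite factS natrM -mulrA; congr (_ * _).
rewrite size_add_box ?(partitions_partition lak) // /ind_elt mulr_sumr linear_sum (bigD1 x) //=.
rewrite (tau_specht_elt_sqr C lak (card_setD1 Xk xX)) -natr1 mulrDr mulr1 addrC; congr (_ + _).
case: k res Xk lak => [_ X1|k res Xk] lak.
  rewrite big1 => [|i /andP[iX ix]].
    by move: lak; rewrite inE => /eqP->; rewrite mulr0.
  have /eqP/cards1P[w Xw] := X1.
  by move: iX ix xX; rewrite Xw !inE => /eqP-> /negPf wx /eqP xw; rewrite xw eqxx in wx.
rewrite (eq_bigr (fun=> k`!%:R * (size (removable la))%:R)) => [|i /andP[iX ix]]; last first.
  by apply: (tau_specht_elt_pair (k := k)); rewrite // eq_sym.
rewrite sumr_const -[X in _ *+ X](_ : #|X :\ x| = _); last first.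
  by apply: eq_card => y; rewrite !inE andbC.
by rewrite (card_setD1 Xk xX) factS natrM -[LHS]mulr_natl mulrA.
Qed.

Lemma add_box_sub k la : la \in partitions k -> {subset add_box la <= partitions k.+1}.
Proof. by move=> lak mu; apply: add_box_partitions. Qed.

Lemma induction_step k : (if k is k'.+1 then restriction_rule k' else True) ->
  induction_rule k.
Proof.
move=> res X la Xk lak; have [x xX] : exists x, x \in X by apply/card_gt0P; rewrite Xk.
set S := \sum_(mu <- _) _; have sub := add_box_sub lak.
apply/eqP; rewrite -subr_eq0; apply/eqP/tau_star_eq0.
have starS : star S = S.
  rewrite star_sum /S big_seq [RHS]big_seq; apply: eq_bigr => mu /sub muk.
  exact: (star_specht_elt C muk Xk).
have starD : star (ind_elt la X - S) = ind_elt la X - S.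
  by rewrite -scaleN1r starD starZ rmorphN rmorph1 starS (star_ind_elt lak Xk) scaleN1r.
apply/eqP; rewrite eq_le tau_star_ge0 andbT starD mulrBl !mulrBr !linearB /=.
rewrite (tau_ind_elt_sqr res Xk lak) (tau_sum_specht_elt Xk (uniq_add_box la) sub) [tau (S * _)]tauC.
(* Both squares have trace (k+1)! times the number of added boxes, so the norm of the difference is
   at most 0 once the mixed trace reaches this value. *)
rewrite opprB -mulr2n pmulrn_lle0 // subr_le0.
rewrite /S mulr_sumr linear_sum /= -(count_predT (add_box la)) mulr_natr -iter_addr_0.
rewrite -big_const_seq big_seq [leRHS]big_seq; apply: ler_sum => mu mula.
rewrite (tau_ind_elt lak Xk xX); last exact: (central_specht_elt C).
have [m [-> m0]] := branching_multiplicity C lak Xk xX mula.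
(* The multiplicity m is a positive integer, hence at least 1. *)
by rewrite factS natrM mulrA ler_peMr ?mulr_ge0 ?ler0n // ler1n.
Qed.

(** Frobenius reciprocity: the pairing is, up to the factor k+1, that of the induced element with
    [mu]. *)
Lemma tau_specht_elt_restrict k la mu X x : induction_rule k -> #|X| = k.+1 ->
    la \in partitions k -> mu \in partitions k.+1 -> x \in X ->
  tau (specht_elt la (X :\ x) * specht_elt mu X) = if mu \in add_box la then k`!%:R else 0.
Proof.
move=> ind Xk lak muk xX; apply: (mulfI (x := k.+1%:R)); first by rewrite pnatr_eq0.
rewrite -(tau_ind_elt lak Xk xX); last exact: (central_specht_elt C).
rewrite (ind X la Xk lak).
rewrite (eq_bigr (fun nu => (fun=> 1) nu *: specht_elt nu X)) => [|nu _]; last by rewrite scale1r.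
rewrite (sum_specht_elt_mul _ Xk (uniq_add_box la) (add_box_sub lak) muk) mul1r.
case: ifP => _; last by rewrite linear0 mulr0.
by rewrite -(specht_elt_sqr C muk Xk) (tau_specht_elt_sqr C muk Xk) factS natrM.
Qed.

Lemma specht_elt_neq0 k la X : la \in partitions k -> #|X| = k -> specht_elt la X != 0.
Proof.
move=> lak Xk; apply: contraTneq isT => y0; have := tau_specht_elt_sqr C lak Xk.
by rewrite y0 mulr0 linear0 => /esym/eqP; rewrite pnatr_eq0 -leqn0 leqNgt fact_gt0.
Qed.

(** The scalar is k!/f for f the dimension, so the second claim says that the dimension of [mu] is
    the sum of the dimensions of the partitions obtained by removing a box. *)
Lemma completeness_step k : induction_rule k -> completeness k ->
  completeness k.+1 /\
  forall X mu x, #|X| = k.+1 -> mu \in partitions k.+1 -> x \in X ->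
    (specht_scalar mu X)^-1 = k.+1%:R^-1 * \sum_(la <- partitions k | mu \in add_box la) (specht_scalar la (X :\ x))^-1.
Proof.
move=> ind com; pose g X x mu := k.+1%:R^-1 *
  \sum_(la <- partitions k | mu \in add_box la) (specht_scalar la (X :\ x))^-1.
(* Adding the decompositions of 1 for all X minus i gives k+1 times 1 on one side and, by the
   induction rule, a combination of elements of size k+1 on the other; [g] is the coefficient
   obtained. *)
have one X x : #|X| = k.+1 -> x \in X -> \sum_(mu <- partitions k.+1) g X x mu *: specht_elt mu X = 1.
  move=> Xk xX; apply: (scalerI (a := k.+1%:R)); first by rewrite pnatr_eq0.
  rewrite scaler_sumr (eq_bigr (fun mu => \sum_(la <- partitions k | mu \in add_box la)
      (specht_scalar la (X :\ x))^-1 *: specht_elt mu X)) => [|mu _]; last first.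
    by rewrite scalerA mulrA divff ?pnatr_eq0 // mul1r scaler_suml.
  rewrite (exchange_big_dep xpredT) //= big_seq.
  transitivity (\sum_(i in X) (1 : GA)); last by rewrite sumr_const Xk scaler_nat.
  transitivity (\sum_(la <- partitions k) (specht_scalar la (X :\ x))^-1 *: ind_elt la X); last first.
    rewrite (eq_bigr (fun la => \sum_(i in X) (specht_scalar la (X :\ x))^-1 *: specht_elt la (X :\ i))).
      rewrite exchange_big /=; apply: eq_bigr => i iX.
      rewrite -(com (X :\ i) (card_setD1 Xk iX)) big_seq [RHS]big_seq.
      apply: eq_bigr => la lak; congr (_^-1 *: _).
      by have [_] := specht_elt_transport C lak (card_setD1 Xk xX) (fun z => swap_point z xX iX).
    by move=> la _; rewrite scaler_sumr.
  rewrite [RHS]big_seq; apply: eq_bigr => la lak.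
  rewrite (ind X la Xk lak) scaler_sumr -big_filter; apply: perm_big.
  apply: uniq_perm => [||mu]; [exact/filter_uniq/partitions_uniq | exact: uniq_add_box |].
  rewrite mem_filter; apply/andP/idP => [[] //|mula].
  by split=> //; apply: add_box_sub mula.
(* Multiplying by the element of [mu] leaves a single term, which determines its coefficient. *)
have gE X x mu : #|X| = k.+1 -> mu \in partitions k.+1 -> x \in X -> (specht_scalar mu X)^-1 = g X x mu.
  move=> Xk muk xX; have := congr1 (fun M => M * specht_elt mu X) (one X x Xk xX).
  rewrite mul1r (sum_specht_elt_mul _ Xk (partitions_uniq _) _ muk) // muk -[RHS]scale1r => /eqP.
  rewrite -subr_eq0 -scalerBl scaler_eq0 (negPf (specht_elt_neq0 muk Xk)) orbF subr_eq0.
  by move=> /eqP e; rewrite -[LHS]mul1r -e mulfK // (specht_scalar_neq0 C muk Xk).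
split; last by move=> X mu x; apply: gE.
move=> X Xk; have [x xX] : exists x, x \in X by apply/card_gt0P; rewrite Xk.
rewrite -(one X x Xk xX) big_seq [RHS]big_seq; apply: eq_bigr => mu muk.
by rewrite (gE X x).
Qed.

(** The truncation [D] of the element of [mu] to the subgroup is central there, so it acts on each
    [la] by a scalar. Frobenius reciprocity gives the scalar, and completeness reassembles [D]. *)
Lemma restriction_step k : induction_rule k -> completeness k -> restriction_rule k.
Proof.
move=> ind com X mu x s Xk muk xX sX; set Y := X :\ x in sX *.
have Yk : #|Y| = k := card_setD1 Xk xX.
pose D := \sum_(s in Sym Y) group_coef (specht_elt mu X) s *: rho s.
have sD : supported (Sym Y) D by apply: supported_sum.
have cD : central (Sym_group Y) D.
  move=> t tY; rewrite /D linear_sum /= [RHS](reindex_inj (conjg_inj t)) /=.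
  apply: eq_big => [u|u uY]; first by rewrite memJ_norm // (subsetP (normG _)).
  rewrite linearZ /= conjr_rho; congr (_ *: _).
  rewrite /group_coef -conjVg -conjr_rho -{2}(@central_specht_elt C T mu X t (subsetP (Sym_D1 X x) t tY)).
  by rewrite -conjrM tau_conjr.
have DE la : la \in partitions k -> (specht_scalar la Y)^-1 *: (D * specht_elt la Y) =
    if mu \in add_box la then specht_elt la Y else 0.
  move=> lak; have := tab_elt_Schur (partitions_partition lak) (specht_tableau lak Yk) cD sD.
  rewrite -/(specht_elt la Y); set t := tau _ => DyE.
  have tE : tau (D * specht_elt la Y) = if mu \in add_box la then k`!%:R else 0.
    (* Pairing with an element supported on [Sym Y] does not see the coefficients that the
       truncation dropped. *)
    rewrite -(tau_specht_elt_restrict ind Xk lak muk xX) [RHS]tauC.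
    rewrite (tauM_supported sD (supported_specht_elt C la Y)); last by move=> u; rewrite groupV.
    rewrite (tauM_supported (supported_specht_elt C mu X) (supported_specht_elt C la Y)); last by move=> u; rewrite groupV.
    rewrite setIid (setIidPr (Sym_D1 X x)); apply: eq_bigr => u uY.
    by rewrite /D group_coef_sum uY.
  move: tE; rewrite DyE linearZ /= (tau_specht_elt C lak Yk); case: ifP => _ tE.
    rewrite scalerA -[RHS]scale1r; congr (_ *: _).
    have f0 : k`!%:R != 0 :> C by rewrite pnatr_eq0 -lt0n fact_gt0.
    by apply: (mulfI f0); rewrite mulr1 -{2}tE mulrA mulrC.
  have c0 : k`!%:R / specht_scalar la Y != 0.
    by rewrite mulf_neq0 ?invr_eq0 ?(specht_scalar_neq0 C lak Yk) // pnatr_eq0 -lt0n fact_gt0.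
  by rewrite (mulIf c0 (etrans tE (esym (mul0r _)))) scale0r scaler0.
transitivity (group_coef D s); first by rewrite /D group_coef_sum sX.
rewrite -group_coef_bigsum; congr (group_coef _ s).
rewrite -[D]mulr1 -(com Y Yk) mulr_sumr [RHS]big_mkcond /= big_seq [RHS]big_seq.
by apply: eq_bigr => la lak; rewrite mulZr DE.
Qed.

(** The symmetric group of the empty set is trivial, so the element is the inverse scalar times 1;
    its norm is 0! = 1, and positivity selects the root 1. *)
Lemma specht_elt_empty : specht_scalar [::] set0 = 1 /\ specht_elt [::] set0 = 1.
Proof.
have p0 : [::] \in partitions 0 by []; have c0 : #|@set0 T| = 0%N := cards0 T.
have k_gt0 := specht_scalar_gt0 C p0 c0; have k0 := specht_scalar_neq0 C p0 c0.
have y1 : specht_elt [::] set0 = (specht_scalar [::] set0)^-1 *: (1 : GA).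
  rewrite [LHS](supported_specht_elt C [::] (@set0 T)) (big_pred1 1%g) => [|s]; last first.
    apply/idP/eqP => [|->]; last exact: (group1 (Sym_group _)).
    move=> s0; apply/permP => y; rewrite perm1 (Sym_out s0) // inE.
    by [].
  by rewrite /group_coef invg1 rho1 mulr1 (tau_specht_elt C p0 c0) fact0 mul1r.
have k1 : specht_scalar [::] set0 = 1.
  have := tau_specht_elt_sqr C p0 c0; rewrite {1 2}y1 mulZl mul1r scalerA linearZ /=.
  rewrite -rho1 tau_rho eqxx mulr1 fact0 -expr2 => /eqP.
  by rewrite pexpr_eq1 ?invr_ge0 ?ltW // invr_eq1 => /eqP.
by rewrite y1 k1 invr1 scale1r.
Qed.

Lemma completeness0 : completeness 0.
Proof.
move=> X /eqP; rewrite cards_eq0 => /eqP ->; rewrite big_seq1.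
by have [-> ->] := specht_elt_empty; rewrite invr1 scale1r.
Qed.

Lemma branching k : [/\ induction_rule k, completeness k & restriction_rule k].
Proof.
elim: k => [|k [ind com res]].
  have ind : induction_rule 0 by apply: induction_step.
  by split=> //; [apply: completeness0 | apply: restriction_step ind completeness0].
have ind' : induction_rule k.+1 by apply: induction_step.
have [com' _] := completeness_step ind com.
by split=> //; apply: restriction_step.
Qed.

End BranchingRule.

(** * The induced element as a sum of squares *)

(** Conjugation compares only sets inside one type. The dimension recursion, which holds in every
    type, makes the comparison with ['I_(sumn la)], where [specht_dim] is computed. *)
Lemma specht_scalar_card (C : numClosedFieldType) k (la : seq nat) (T T' : finType)
    (X : {set T}) (Y : {set T'}) :
  la \in partitions k -> #|X| = k -> #|Y| = k -> specht_scalar C la X = specht_scalar C la Y.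
Proof.
elim: k la T T' X Y => [|k IH] la T T' X Y lak Xk Yk.
  move: lak; rewrite inE => /eqP->.
  move/eqP: Xk; rewrite cards_eq0 => /eqP->; move/eqP: Yk; rewrite cards_eq0 => /eqP->.
  by rewrite (proj1 (specht_elt_empty C T)) (proj1 (specht_elt_empty C T')).
have [x xX] : exists x, x \in X by apply/card_gt0P; rewrite Xk.
have [y yY] : exists y, y \in Y by apply/card_gt0P; rewrite Yk.
have rule (S : finType) := completeness_step (let: And3 i _ _ := branching C S k in i)
  (let: And3 _ c _ := branching C S k in c).
apply: invr_inj; rewrite (proj2 (rule T) X la x Xk lak xX) (proj2 (rule T') Y la y Yk lak yY).
congr (_ * _); rewrite big_seq_cond [RHS]big_seq_cond; apply: eq_bigr => nu /andP[nuk _].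
by congr _^-1; apply: IH => //; apply: card_setD1.
Qed.

Lemma specht_dimE (C : numClosedFieldType) k (la : seq nat) (T : finType) (X : {set T}) :
  la \in partitions k -> #|X| = k -> (specht_dim C la)%:R = k`!%:R / specht_scalar C la X.
Proof.
move=> lak Xk; have sla := partitions_sumn lak.
have c : #|[set: 'I_(sumn la)]| = sumn la by rewrite cardsT card_ord.
rewrite /specht_dim (specht_rank C (partitions_partition lak) (esym c)) c.
rewrite -(specht_scalar_card C lak (etrans c sla) Xk) -/(specht_scalar C la _).
by rewrite [in X in X`!%:R]sla.
Qed.

Section SumOfSquares.

Variables (C : numClosedFieldType) (T : finType).
Local Notation GA := 'M[C]_#|[set: {perm T}]%G|.
Local Notation rho := (@rho C {perm T}).
Local Notation specht_elt := (@specht_elt C T).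
Local Notation specht_scalar := (@specht_scalar C T).
Local Notation ind_elt := (@ind_elt C T).

Variables (k : nat) (la : seq nat) (X : {set T}) (x : T).
Hypotheses (lak : la \in partitions k) (Xk : #|X| = k.+1) (xX : x \in X).

Let ind : ind_elt la X = \sum_(mu <- add_box la) specht_elt mu X.
Proof. by have [i _ _] := branching C T k; apply: i. Qed.

Definition specht_proj mu : GA := (specht_scalar mu X)^-1 *: specht_elt mu X.
Definition specht_proj0 : GA := (specht_scalar la (X :\ x))^-1 *: specht_elt la (X :\ x).

Let Yk := card_setD1 Xk xX.
Let sub := add_box_sub lak.

Lemma star_specht_proj mu : mu \in partitions k.+1 -> star (specht_proj mu) = specht_proj mu.
Proof.
move=> muk; rewrite starZ (star_specht_elt C muk Xk) fmorphV /=; congr (_^-1 *: _).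
exact: (tab_scalar_real C (specht_tableau muk Xk)).
Qed.

Lemma star_specht_proj0 : star specht_proj0 = specht_proj0.
Proof.
rewrite starZ (star_specht_elt C lak Yk) fmorphV /=; congr (_^-1 *: _).
exact: (tab_scalar_real C (specht_tableau lak Yk)).
Qed.

Lemma specht_proj_idem mu : mu \in partitions k.+1 -> specht_proj mu * specht_proj mu = specht_proj mu.
Proof.
move=> muk; rewrite mulZl mulZr (specht_elt_sqr C muk Xk) 2!scalerA -mulrA mulVf ?mulr1 //.
exact: (specht_scalar_neq0 C muk Xk).
Qed.

Lemma specht_proj0_idem : specht_proj0 * specht_proj0 = specht_proj0.
Proof.
rewrite mulZl mulZr (specht_elt_sqr C lak Yk) 2!scalerA -mulrA mulVf ?mulr1 //.
exact: (specht_scalar_neq0 C lak Yk).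
Qed.

Lemma specht_proj_comm mu : specht_proj mu * specht_proj0 = specht_proj0 * specht_proj mu.
Proof.
apply: (centralC (H := Sym_group X)); first by apply: centralZ; apply: central_specht_elt.
by apply: supportedZ; apply: supportedS (Sym_D1 X x) (supported_specht_elt _ _ _).
Qed.

(** The trace of the induction rule: the dimensions of the partitions above [la] add up to k+1 times
    that of [la]. *)
Lemma sum_specht_scalarV : \sum_(mu <- add_box la) (specht_scalar mu X)^-1 = (specht_scalar la (X :\ x))^-1.
Proof.
have := congr1 (@tau C {perm T}) ind; rewrite -[ind_elt _ _]mulr1.
rewrite (tau_ind_elt lak Xk xX); last by move=> s _; rewrite /conjr mulr1 rhoVK.
rewrite mulr1 linear_sum /= (tau_specht_elt C lak Yk) big_seq.
rewrite (eq_bigr (fun mu => k.+1`!%:R * (specht_scalar mu X)^-1)) => [|mu /sub muk]; last first.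
  by rewrite (tau_specht_elt C muk Xk).
rewrite -big_seq -mulr_sumr mulrA -natrM -factS => /mulfI -> //.
by rewrite pnatr_eq0 -lt0n fact_gt0.
Qed.

(** The sum S of the projections above is a projection commuting with [specht_proj0], and the trace
    of their product is already that of [specht_proj0]. The difference therefore has norm 0. *)
Lemma specht_proj0_sum : specht_proj0 * \sum_(mu <- add_box la) specht_proj mu = specht_proj0.
Proof.
set S := \sum_(mu <- _) _.
have starS : star S = S.
  by rewrite star_sum /S big_seq [RHS]big_seq; apply: eq_bigr => mu /sub/star_specht_proj.
have SS : S * S = S.
  rewrite {2}/S mulr_sumr big_seq [RHS]big_seq; apply: eq_bigr => mu mula.
  rewrite mulZr (sum_specht_elt_mul _ Xk (uniq_add_box la) sub (sub mula)) mula.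
  by rewrite mulVf ?scale1r // (specht_scalar_neq0 C (sub mula) Xk).
have S0 : S * specht_proj0 = specht_proj0 * S.
  by rewrite mulr_suml mulr_sumr; apply: eq_bigr => mu _; apply: specht_proj_comm.
have tS : tau (specht_proj0 * S) = tau specht_proj0.
  rewrite mulr_sumr linear_sum big_seq /=.
  rewrite (eq_bigr (fun mu => (specht_scalar la (X :\ x))^-1 * (k`!%:R * (specht_scalar mu X)^-1))) => [|mu mula].
    rewrite -big_seq -!mulr_sumr sum_specht_scalarV /specht_proj0 linearZ /= (tau_specht_elt C lak Yk) //.
  rewrite mulZl mulZr !linearZ /=.
  have [i _ _] := branching C T k.
  rewrite (tau_specht_elt_restrict i Xk lak (sub mula) xX) mula [_ * k`!%:R]mulrC //.
apply/eqP; rewrite -subr_eq0; apply/eqP/tau_star_eq0.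
have -> : star (specht_proj0 * S - specht_proj0) = S * specht_proj0 - specht_proj0.
  by rewrite -!scaleN1r starD starZ starM starS star_specht_proj0 rmorphN rmorph1.
have pE : specht_proj0 * (specht_proj0 * S) = specht_proj0 * S by rewrite mulrA specht_proj0_idem.
have Ep : specht_proj0 * S * specht_proj0 = specht_proj0 * S by rewrite -mulrA S0 pE.
have EE : specht_proj0 * S * (specht_proj0 * S) = specht_proj0 * S by rewrite mulrA Ep -mulrA SS.
rewrite S0 mulrBl !mulrBr EE Ep pE specht_proj0_idem subrr sub0r opprB.
by rewrite linearB /= tS subrr.
Qed.

(** On the block of [mu], with p its projection, h its scalar and q = [specht_proj0], the difference
    is h p - t q p = (h - t) p + t p (1 - q). Both p and p (1 - q) are projections, hence of the
    form N N*. *)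
Lemma ind_elt_sum_squares (t := 2 * specht_scalar la (X :\ x)) :
  ind_elt la X - 2 *: specht_elt la (X :\ x) = \sum_(mu <- add_box la)
    ((specht_scalar mu X - t) *: (specht_proj mu * star (specht_proj mu)) +
     t *: (specht_proj mu * (1 - specht_proj0) * star (specht_proj mu * (1 - specht_proj0)))).
Proof.
rewrite ind; have -> : 2 *: specht_elt la (X :\ x) = t *: specht_proj0.
  by rewrite [RHS]scalerA /t mulfK // (specht_scalar_neq0 C lak Yk).
rewrite -{1}specht_proj0_sum mulr_sumr scaler_sumr -sumrB big_seq [RHS]big_seq.
apply: eq_bigr => mu /sub muk.
have star_q : star (1 - specht_proj0) = 1 - specht_proj0.
  rewrite -scaleN1r starD starZ star_specht_proj0 rmorphN rmorph1 scaleN1r.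
  by rewrite -rho1 star_rho invg1.
have q_q : (1 - specht_proj0) * (1 - specht_proj0) = 1 - specht_proj0.
  by rewrite mulrBr mulr1 mulrBl mul1r specht_proj0_idem subrr subr0.
rewrite starM star_q star_specht_proj // specht_proj_idem // mulrA -[_ * (1 - specht_proj0) * (1 - specht_proj0)]mulrA q_q.
have key (p q : GA) (a b : C) : a *: p - b *: (q * p) = (a - b) *: p + b *: (p - q * p).
  by rewrite scalerBr addrA -scalerDl subrK.
have key2 (p q : GA) : p * p = p -> p * q = q * p -> p * (1 - q) * p = p - q * p.
  by move=> pp pq; rewrite mulrBr mulr1 mulrBl pq -mulrA pp.
rewrite (key2 _ _ (specht_proj_idem muk) (specht_proj_comm mu)) -key; congr (_ - _); rewrite [RHS]scalerA divff ?scale1r //.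
exact: (specht_scalar_neq0 C muk Xk).
Qed.

End SumOfSquares.

(** * Positivity *)

Section Positivity.

Variables (C : numClosedFieldType) (n : nat).
Local Notation G := [set: 'S_n]%G.
Local Notation GA := 'M[C]_#|G|.
Local Notation rho := (@rho C 'S_n).
Implicit Types (M N : GA).

Lemma psdmx_sqr m (A : 'M[C]_m) : psdmx (A *m A ^t*).
Proof.
split; first by rewrite is_hermitianmxE expr0 scale1r trmx_mul map_mxM trmxCK.
move=> v; rewrite map_trmx mulmxA -mulmxA.
have -> : A ^t* *m v ^t* = (v *m A) ^t* by rewrite trmx_mul map_mxM.
rewrite mxE sumr_ge0 // => i _; rewrite !mxE; exact: mul_conjC_ge0.
Qed.

Lemma psdmxD m (A B : 'M[C]_m) : psdmx A -> psdmx B -> psdmx (A + B).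
Proof.
move=> [/is_hermitianmxP hA pA] [/is_hermitianmxP hB pB]; split=> [|v].
  rewrite is_hermitianmxE; apply/eqP; rewrite {1}hA {1}hB -scalerDr; congr (_ *: _).
  by rewrite -map_mxD -linearD.
by rewrite mulmxDr mulmxDl mxE addr_ge0.
Qed.

Lemma psdmxZ m a (A : 'M[C]_m) : 0 <= a -> psdmx A -> psdmx (a *: A).
Proof.
move=> a0 [/is_hermitianmxP hA pA]; split=> [|v]; last first.
  by rewrite -scalemxAr -scalemxAl mxE mulr_ge0.
rewrite is_hermitianmxE linearZ /= map_mxZ; apply/eqP; rewrite {1}hA !scale1r.
by congr (_ *: _); apply/esym/conj_Creal; rewrite realE a0.
Qed.

Lemma supported_group_ring M : supported G M <-> (M \in group_ring C G)%MS.
Proof.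
split=> [sM|/envelop_mxP[f ->]]; last by apply: supported_sum.
by apply/envelop_mxP; exists (group_coef M).
Qed.

Lemma perm_coefE M s : supported G M -> perm_coef M s = group_coef M s.
Proof.
by move=> sM; rewrite -(gring_row_subreg (H := G) M (in_setT s)) /perm_coef {1}sM.
Qed.

Lemma perm_starE M : supported G M -> perm_star M = star M.
Proof.
move=> sM; rewrite {2}sM star_sum; apply: eq_big => [s|s _]; first by rewrite inE.
by rewrite starZ star_rho perm_coefE.
Qed.

Lemma supported_star M : supported G M -> supported G (star M).
Proof.
move=> ->; rewrite star_sum; apply: supported_big => s _.
by rewrite starZ star_rho; apply: supportedZ; apply: supported_rho; rewrite inE.
Qed.

(** In a unitary representation the inverse of a group element acts by the adjoint matrix. *)
Lemma gring_op_star m (rG : mx_representation C G m) M : unitary_repr rG -> supported G M ->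
  gring_op rG (star M) = (gring_op rG M) ^t*.
Proof.
move=> uG ->; rewrite star_sum !linear_sum map_mx_sum; apply: eq_bigr => s _.
rewrite starZ star_rho !linearZ /= !gring_opG ?inE //.
rewrite map_mxZ; congr (_ *: _).
by rewrite repr_mxV ?inE // invmx_unitary.
Qed.

Lemma perm_alg_ge0_sqr N : supported G N -> perm_alg_ge0 (N * star N).
Proof.
move=> sN; have sN' := supported_star sN; have sNN : supported G (N * star N) by apply: supportedM.
split; [exact/supported_group_ring | by rewrite perm_starE // starM starK |].
move=> m rG uG; rewrite -mulmxE gring_opM; last exact/supported_group_ring.
by rewrite gring_op_star //; apply: psdmx_sqr.
Qed.

Lemma perm_alg_ge0D M N : perm_alg_ge0 M -> perm_alg_ge0 N -> perm_alg_ge0 (M + N).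
Proof.
move=> [/supported_group_ring sM eM pM] [/supported_group_ring sN eN pN].
split; first by apply/supported_group_ring/supportedD.
  by rewrite (perm_starE (supportedD sM sN)) starD -(perm_starE sM) -(perm_starE sN) eM eN.
by move=> m rG uG; rewrite linearD /=; apply: psdmxD; [apply: pM | apply: pN].
Qed.

Lemma perm_alg_ge0Z a M : 0 <= a -> perm_alg_ge0 M -> perm_alg_ge0 (a *: M).
Proof.
move=> a0 [/supported_group_ring sM eM pM]; split; first by apply/supported_group_ring/supportedZ.
  rewrite (perm_starE (supportedZ a sM)) starZ -(perm_starE sM) eM; congr (_ *: _).
  by apply: conj_Creal; rewrite realE a0.
by move=> m rG uG; rewrite linearZ /=; apply: psdmxZ => //; apply: pM.
Qed.

Lemma perm_alg_ge0_0 : perm_alg_ge0 (0 : GA).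
Proof. by have := perm_alg_ge0_sqr (supported0 C G); rewrite mul0r. Qed.

Lemma perm_alg_ge0_sum I (r : seq I) (P : pred I) (F : I -> GA) :
  (forall i, P i -> perm_alg_ge0 (F i)) -> perm_alg_ge0 (\sum_(i <- r | P i) F i).
Proof.
by move=> pF; apply: big_ind => //; [apply: perm_alg_ge0_0 | apply: perm_alg_ge0D].
Qed.

End Positivity.

(** * Regrouping the Plücker sum around the negative weight *)

Section Pluecker.

Variables (C : numClosedFieldType) (n k : nat) (la : seq nat) (u : 'I_n -> C) (w : 'I_n).
Local Notation GA := 'M[C]_#|[set: 'S_n]%G|.
Local Notation specht_elt := (@specht_elt C 'I_n la).
Local Notation y a := (u a)^-1.
Implicit Types X W : {set 'I_n}.

Hypothesis lak : la \in partitions k.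

Lemma supportedT_specht_elt X : supported [set: 'S_n]%G (specht_elt X).
Proof. exact: supportedS (subsetT _) (supported_specht_elt C la X). Qed.

Lemma perm_alg_ge0_specht_elt X : #|X| = k -> perm_alg_ge0 (specht_elt X).
Proof.
move=> Xk; have -> : specht_elt X = (specht_scalar C la X)^-1 *: (specht_elt X * star (specht_elt X)).
  by rewrite (star_specht_elt C lak Xk) (specht_elt_sqr C lak Xk) scalerA mulVf ?scale1r // (specht_scalar_neq0 C lak Xk).
apply: perm_alg_ge0Z; first by rewrite invr_ge0 ltW ?(specht_scalar_gt0 C lak Xk).
exact/perm_alg_ge0_sqr/supportedT_specht_elt.
Qed.

Hypothesis bal : forall mu, mu \in add_box la ->
  (2 * specht_dim C mu <= k.+1 * specht_dim C la)%N.

Lemma perm_alg_ge0_ind_elt X x : #|X| = k.+1 -> x \in X ->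
  perm_alg_ge0 (ind_elt C la X - 2 *: specht_elt (X :\ x)).
Proof.
move=> Xk xX; have Yk := card_setD1 Xk xX; rewrite (ind_elt_sum_squares C lak Xk xX).
have spr mu : supported [set: 'S_n]%G (specht_proj C X mu).
  by apply: supportedZ; apply: supportedS (subsetT _) (supported_specht_elt C mu X).
rewrite big_seq; apply: perm_alg_ge0_sum => mu mula.
have muk := add_box_sub lak mula.
have k_gt0 := specht_scalar_gt0 C muk Xk; have k'_gt0 := specht_scalar_gt0 C lak Yk.
apply: perm_alg_ge0D; apply: perm_alg_ge0Z.
(* Substituting the dimensions as factorials over scalars turns balance into: the scalar of [mu] is
   at least twice that of [la]. *)
- have := bal mula; rewrite -(ler_nat C) !natrM.
  rewrite (specht_dimE C muk Xk) (specht_dimE C lak Yk) [X in _ <= X]mulrA -natrM -factS.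
  rewrite mulrCA ler_pM2l ?ltr0n ?fact_gt0 // ler_pdivrMr //.
  by rewrite mulrC ler_pdivlMr // subr_ge0.
- exact: perm_alg_ge0_sqr.
- by rewrite mulr_ge0 // ltW.
apply: perm_alg_ge0_sqr; apply: supportedM => //.
apply: supportedD; first by rewrite -rho1; apply: supported_rho; rewrite inE.
rewrite -scaleN1r; apply: supportedZ; apply: supportedZ; exact: supportedT_specht_elt.
Qed.

Hypotheses (pos : forall a, a != w -> 0 < u a) (neg : u w < 0).
Hypothesis hsum : \sum_a y a <= 0.

Let F X := \prod_(a in X :\ w) y a.

(** Substitute X for W minus i; the set X still contains w because i differs from w. *)
Lemma reindex_removal (Phi : {set 'I_n} -> 'I_n -> GA) :
  \sum_(W : {set 'I_n} | (w \in W) && (#|W| == k.+1)) \sum_(i in W :\ w) Phi W i =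
  \sum_(X : {set 'I_n} | (w \in X) && (#|X| == k)) \sum_(i in ~: X) Phi (i |: X) i.
Proof.
rewrite !pair_big_dep /= (reindex_onto (fun p : {set 'I_n} * 'I_n => (p.2 |: p.1, p.2))
  (fun p => (p.1 :\ p.2, p.2))) /=; last first.
  by move=> [W i] /= /andP[_]; rewrite !inE => /andP[_ iW]; rewrite setD1K.
apply: eq_bigl => -[X i] /=; rewrite xpair_eqE eqxx andbT !inE eqxx /=.
case: (boolP (i \in X)) => iX /=.
  rewrite andbF; apply/negP => /andP[_ /eqP e].
  by have := in_setD1 i (i |: X) i; rewrite e iX eqxx.
rewrite setU1K // eqxx andbT cardsU1 iX add1n eqSS andbT.
case: (eqVneq i w) iX => [->|iw] iX; rewrite ?andbT ?andbF ?(negPf iX) //=.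
Qed.

Lemma sum_delete (Phi : {set 'I_n} -> GA) :
  \sum_(X : {set 'I_n} | (w \notin X) && (#|X| == k)) Phi X =
  \sum_(W : {set 'I_n} | (w \in W) && (#|W| == k.+1)) Phi (W :\ w).
Proof.
rewrite (reindex_onto (fun W => W :\ w) (fun X => w |: X)) /=; last first.
  by move=> X /andP[wX _]; rewrite setU1K.
apply: eq_bigl => W; rewrite !inE eqxx /=; case: (boolP (w \in W)) => wW.
  by rewrite setD1K // eqxx andbT [in RHS](cardsD1 w) wW add1n eqSS.
by apply/negP => /andP[_ /eqP e]; move: wW; rewrite -e !inE eqxx.
Qed.

Lemma plucker_sum_ge0 :
  perm_alg_ge0 (\sum_(X : {set 'I_n} | #|X| == k) (\prod_(a in ~: X) u a) *: specht_elt X).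
Proof.
have u0 a : u a != 0 by case: (eqVneq a w) => [->|/pos]; [rewrite lt_eqF | move/gt_eqF->].
pose U := \prod_a u a.
have UE : U = u w * \prod_(a | a != w) u a by rewrite /U (bigD1 w).
(* Exactly one factor of [U] is negative. *)
have U0 : 0 <= - U.
  rewrite UE oppr_ge0 mulr_le0_ge0 ?ltW //; apply: prodr_gt0 => a; exact: pos.
have F0 X : 0 <= F X by apply: prodr_ge0 => a; rewrite !inE invr_ge0 => /andP[aw _]; rewrite ltW ?pos.
have prodE X : \prod_(a in ~: X) u a = U * \prod_(a in X) y a.
  have one : \prod_(a in X) (u a * y a) = 1 by rewrite big1 // => a _; rewrite mulfV.
  rewrite /U [X in _ = X * _](bigID (mem X)) /= mulrAC -big_split /= one mul1r.
  by apply: eq_bigl => a; rewrite inE.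
(* This equals minus the sum of the [y i] over w and the complement of X, which is what the
   regrouping produces; in the present form it is visibly nonnegative. *)
pose coefX X := - (\sum_a y a) + \sum_(i in X :\ w) y i.
suff -> : \sum_(X : {set 'I_n} | #|X| == k) (\prod_(a in ~: X) u a) *: specht_elt X =
  \sum_(X : {set 'I_n} | (w \in X) && (#|X| == k)) ((- U) * coefX X * F X) *: specht_elt X +
  \sum_(W : {set 'I_n} | (w \in W) && (#|W| == k.+1))
     ((- U) * F W) *: (ind_elt C la W - 2 *: specht_elt (W :\ w)).
  apply: perm_alg_ge0D; apply: perm_alg_ge0_sum => X /andP[wX /eqP Xk].
    apply: perm_alg_ge0Z; last exact: perm_alg_ge0_specht_elt.
    rewrite !mulr_ge0 // addr_ge0 ?oppr_ge0 // sumr_ge0 // => i.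
    by rewrite !inE invr_ge0 => /andP[iw _]; rewrite ltW ?pos.
  by apply: perm_alg_ge0Z; [rewrite mulr_ge0 | apply: perm_alg_ge0_ind_elt].
(* One of the two subtracted copies cancels the term i = w of the induced element. *)
have indE W : w \in W -> ind_elt C la W - 2 *: specht_elt (W :\ w) =
    \sum_(i in W :\ w) specht_elt (W :\ i) - specht_elt (W :\ w).
  move=> wW; rewrite /ind_elt (big_setD1 w) //= scaler_nat mulr2n opprD addrA.
  by rewrite [specht_elt _ + _]addrC addrK.
rewrite [X in _ = _ + X](eq_bigr (fun W => \sum_(i in W :\ w) (- U * F W) *: specht_elt (W :\ i) -
    (- U * F W) *: specht_elt (W :\ w))); last first.
  by move=> W /andP[wW _]; rewrite indE // scalerBr scaler_sumr.
rewrite sumrB (reindex_removal (fun W i => (- U * F W) *: specht_elt (W :\ i))).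
(* Compare separately the sets containing w and those avoiding it. *)
rewrite addrA -big_split /= (bigID (fun X => w \in X)) /=; congr (_ + _).
  apply: eq_big => [X|X /andP[Xk wX]]; first by rewrite andbC.
  rewrite (eq_bigr (fun i => (- U * F X * y i) *: specht_elt X)) => [|i]; last first.
    rewrite inE => iX; have iw : i != w by apply: contraNneq iX => ->.
    rewrite setU1K // /F (_ : (i |: X) :\ w = i |: (X :\ w)); last first.
      by apply/setP => a; rewrite !inE; case: (eqVneq a i) => [->|]; rewrite ?iw.
    by rewrite big_setU1 ?inE ?(negPf iX) ?andbF //= -mulrA [y i * _]mulrC !mulrA.
  rewrite -scaler_suml -scalerDl; congr (_ *: _).
  rewrite prodE (big_setD1 w) //= -/(F X) -mulr_sumr.
  have -> : coefX X = - y w - \sum_(i in ~: X) y i.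
    rewrite /coefX (bigID (mem X)) /= (big_setD1 w) //=.
    have -> : \sum_(i | i \notin X) y i = \sum_(i in ~: X) y i.
      by apply: eq_bigl => i; rewrite inE.
    rewrite !opprD -!addrA; congr (_ + _).
    by rewrite [- (\sum_(i in ~: X) _) + _]addrC addrA addNr add0r.
  by rewrite mulrBr mulrBl [- U * F X * _]mulrAC subrK mulrNN mulrA.
(* A set avoiding w is W minus w for a unique W, and its coefficient [U * F W] is the one left over
   from the subtracted term. *)
rewrite (eq_bigl (fun X => (w \notin X) && (#|X| == k))); last by move=> X; rewrite andbC.
rewrite (sum_delete (fun X => (\prod_(a in ~: X) u a) *: specht_elt X)) -[RHS]scaleN1r scaler_sumr.
by apply: eq_bigr => W _; rewrite [RHS]scalerA prodE mulN1r mulNr opprK.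
Qed.

End Pluecker.

(** Clearing denominators calls for a nonzero dimension: a quotient by 0 is 0 and would carry no
    information. *)
Lemma branching_balanced_dim (F : fieldType) (la mu : seq nat) :
    branching_balanced F la -> specht_dim F la != 0%N -> mu \in add_box la ->
  (2 * specht_dim F mu <= (sumn la).+1 * specht_dim F la)%N.
Proof.
case=> pla _ bal f0 mula; have : p_up F la mu <= 2%:R^-1.
  by apply: le_trans bal; apply: (le_bigmax_seq 0 mu xpredT (p_up F la) mula isT).
rewrite /p_up -natrM ler_pdivrMr ?ltr0n ?muln_gt0 ?lt0n // ler_pdivlMl ?ltr0n //.
by rewrite -natrM ler_nat.
Qed.

Local Open Scope complex_scope.

Theorem corollary3p1 (R : realType) (k n : nat) (la : seq nat) (u : 'I_n -> R)
    (hk : (1 <= k)%N) (hkn : (k <= n)%N)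
    (hla : partition_of k la) (hbal : branching_balanced R[i] la)
    (hpos : forall a : 'I_n, (a.+1 < n)%N -> 0 < u a)
    (hneg : forall a : 'I_n, a.+1 = n -> u a < 0)
    (hsum : \sum_(a < n) (u a)^-1 <= 0) :
  perm_alg_ge0 (plucker la (fun a => (u a)%:C)).
Proof.
have lak : la \in partitions k by rewrite mem_partitions.
have sla := partitions_sumn lak.
case: n u hkn hpos hneg hsum => [|n] u hkn hpos hneg hsum; first by case: k hk hkn {hla lak sla}.
have dim0 : specht_dim R[i] la != 0%N.
  have c : #|[set: 'I_k]| = k by rewrite cardsT card_ord.
  rewrite -(pnatr_eq0 R[i]) (specht_dimE _ lak c) mulf_neq0 ?invr_eq0 ?(specht_scalar_neq0 _ lak c) //.
  by rewrite pnatr_eq0 -lt0n fact_gt0.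
rewrite /plucker sla.
rewrite (eq_bigr (fun X : {set 'I_n.+1} => (\prod_(a in ~: X) (u a)%:C) *: specht_elt R[i] la X)).
  (* Indices start at 0, so [ord_max] is the index of the last weight, the negative one. *)
  apply: (plucker_sum_ge0 (w := ord_max) lak).
  - by move=> mu /(branching_balanced_dim hbal dim0); rewrite sla.
  - move=> a aw; rewrite ltcR hpos // ltnS ltn_neqAle -ltnS ltn_ord andbT.
    by apply: contraNneq aw => e; apply/eqP/val_inj.
  - by rewrite ltcR hneg.
  rewrite (eq_bigr (fun a => ((u a)^-1)%:C)) => [|a _]; last by rewrite fmorphV.
  by rewrite -rmorph_sum lecR.
move=> X /eqP Xk; congr (_ *: _); apply: specht_sum; last by rewrite sla.
exact: partitions_partition lak.
Qed.
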